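(* Let $(\lambda,k)\in\sigma_D\times\mathbb Z_N$ and let $\mathcal H_k(\lambda)=\{\psi\in\mathfrak D(H_k):H_k\psi=\lambda\psi\}$. (i) Every eigenfunction in $\mathcal H_k(\lambda)$ vanishes at all vertices of $\Gamma^1$. (ii) Let $\varphi=\varphi(\cdot,\lambda)|_{[0,1]}$, $c=\varphi'(1,\lambda)$, $\eta=1-s^kc^2$. Define $\psi^{(0)}=(\psi^{(0)}_\alpha)_{\alpha\in\mathbb Z\times\{0,1,2\}}$ as follows. If $\eta\neq0$: $\psi^{(0)}_{n,j}=0$ for all $n\ne0,-1$ and $j\in\{0,1,2\}$, and $$\psi^{(0)}_{0,0}=\eta\varphi,\ \psi^{(0)}_{0,1}=c\varphi,\ \psi^{(0)}_{0,2}=c^2\varphi,\ \psi^{(0)}_{-1,0}=0,\ \psi^{(0)}_{-1,1}=-s^kc\varphi,\ \psi^{(0)}_{-1,2}=-\varphi .$$ If $\eta=0$: $\psi^{(0)}_{0,0}=0$, $\psi^{(0)}_{0,1}=\varphi$, $\psi^{(0)}_{0,2}=c\varphi$, and $\psi^{(0)}_{n,j}=0$ for all $n\neq0$, $j\in\{0,1,2\}$. For $n\in\mathbb Z$ let $\psi^{(n)}=(\psi^{(0)}_{p-n,j})_{(p,j)\in\mathbb Z\times\{0,1,2\}}$. Then each $\psi^{(n)}\in\mathcal H_k(\lambda)$, and each $f\in\mathcal H_k(\lambda)$ has the form $$f=\sum_{n\in\mathbb Z}\widehat f_n\psi^{(n)},\qquad \widehat f_n=\begin{cases}\eta^{-1}f'_{n,0}(0)&\text{if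 }\eta\neq0,\\ f'_{n,1}(0)&\text{if }\eta=0,\end{cases}\qquad (\widehat f_n)_{n\in\mathbb Z}\in\ell^2 .$$ Moreover the map $f\mapsto(\widehat f_n)_{n\in\mathbb Z}$ is a linear isomorphism between $\mathcal H_k(\lambda)$ and $\ell^2(\mathbb Z)$.
   Context: Fix an integer $m\ge0$, $N=2m+1$, $s=e^{2\pi i/N}$, and a real-valued $q\in L^2(0,1)$. Let $\varphi(x,\lambda)$ be the solution of $-y''+qy=\lambda y$ with $\varphi(0,\lambda)=0$, $\varphi'(0,\lambda)=1$, and $\sigma_D=\{\lambda:\varphi(1,\lambda)=0\}$ (Dirichlet spectrum on $[0,1]$). Graph $\Gamma^1$: edges $\Gamma_{n,j}$, $(n,j)\in\mathbb Z\times\{0,1,2\}$, each identified with $[0,1]$; its vertices are, for each $n\in\mathbb Z$, the point joining the end $t=1$ of $\Gamma_{n,0}$, the end $t=0$ of $\Gamma_{n,1}$ and the end $t=1$ of $\Gamma_{n,2}$, and the point joining the end $t=0$ of $\Gamma_{n+1,0}$, the end $t=1$ of $\Gamma_{n,1}$ and the end $t=0$ of $\Gamma_{n,2}$. For $k\in\mathbb Z_N$ the self-adjoint operator $H_k$ in $L^2(\Gamma^1)=\bigoplus L^2(0,1)$ acts by $(H_kf)_\alpha=-f_\alpha''+qf_\alpha$ on the domain $\mathfrak D(H_k)$ of $f\in L^2(\Gamma^1)$ with $f_\alpha\in W^{2,2}(0,1)$, $(f_\alpha'')\in L^2(\Gamma^1)$ and, for all $n\in\mathbb Z$: $f_{n,0}(1)=f_{n,1}(0)=s^kf_{n,2}(1)$,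 $f_{n+1,0}(0)=f_{n,1}(1)=f_{n,2}(0)$, $-f'_{n,0}(1)+f'_{n,1}(0)-s^kf'_{n,2}(1)=0$, $f'_{n+1,0}(0)-f'_{n,1}(1)+f'_{n,2}(0)=0$. *)

(* Defs.v *)
From HB Require Import structures.
From mathcomp Require Import all_boot all_order all_algebra.
From mathcomp Require Import all_classical all_reals all_analysis.
From mathcomp Require Import complex.
Set Implicit Arguments. Unset Strict Implicit. Unset Printing Implicit Defensive.
Import Order.TTheory GRing.Theory Num.Theory.
Import numFieldNormedType.Exports.
Local Open Scope classical_set_scope.
Local Open Scope ring_scope.
Local Open Scope complex_scope.

Section Defs.
Variable R : realType.

Definition leb := @lebesgue_measure R.

Definition I01 : set R := `[0%R, 1%R].

Definition nc2 (z : R[i]) : R := (complex.Re z) ^+ 2 + (complex.Im z) ^+ 2.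

Definition L2r (g : R -> R) : Prop :=
  measurable_fun I01 g /\ (\int[leb]_(x in I01) ((g x) ^+ 2)%:E < +oo)%E.

Definition L2c (f : R -> R[i]) : Prop :=
  L2r (fun x => complex.Re (f x)) /\ L2r (fun x => complex.Im (f x)).

Definition normL2sq (f : R -> R[i]) : \bar R :=
  (\int[leb]_(x in I01) (nc2 (f x))%:E)%E.

Definition cint (f : R -> R[i]) (a b : R) : R[i] :=
  (Rintegral leb `[a, b] (fun x => complex.Re (f x)))
    +i* (Rintegral leb `[a, b] (fun x => complex.Im (f x))).

(* f in W^{2,2}(0,1) with (continuous) first derivative f1 and second
   derivative f2 in L^2(0,1):  f(x) = f(0) + int_0^x f1,
   f1(x) = f1(0) + int_0^x f2 for x in [0,1]. *)
Definition W22w (f f1 f2 : R -> R[i]) : Prop :=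
  L2c f2 /\
  forall x, x \in I01 -> f x = f 0 + cint f1 0 x /\ f1 x = f1 0 + cint f2 0 x.

Definition dR0 (f : R -> R[i]) : R[i] :=
  (lim ((fun h => (complex.Re (f h) - complex.Re (f 0)) / h) @ 0^'+))
    +i* (lim ((fun h => (complex.Im (f h) - complex.Im (f 0)) / h) @ 0^'+)).
Definition dL1 (f : R -> R[i]) : R[i] :=
  (lim ((fun h => (complex.Re (f 1) - complex.Re (f (1 - h))) / h) @ 0^'+))
    +i* (lim ((fun h => (complex.Im (f 1) - complex.Im (f (1 - h))) / h) @ 0^'+)).

(* functions on the graph Gamma^1: one function per edge (n,j) *)
Definition fam := int -> 'I_3 -> R -> R[i].
Definition e0 : 'I_3 := @Ordinal 3 0 isT.
Definition e1 : 'I_3 := @Ordinal 3 1 isT.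
Definition e2 : 'I_3 := @Ordinal 3 2 isT.

Definition L2Gamma (f : fam) : Prop :=
  (forall n j, L2c (f n j)) /\
  (\esum_(a in [set: int * 'I_3]) normL2sq (f a.1 a.2) < +oo)%E.

Definition sN (m : nat) : R[i] :=
  (cos (2 * pi / (2 * m + 1)%:R)) +i* (sin (2 * pi / (2 * m + 1)%:R)).
Definition sk (m : nat) (k : 'I_(2 * m + 1)) : R[i] := sN m ^+ k.

Definition vertex_conds (m : nat) (k : 'I_(2 * m + 1)) (f : fam) : Prop :=
  forall n : int,
    [/\ f n e0 1 = f n e1 0 /\ f n e1 0 = sk k * f n e2 1,
        f (n + 1)%R e0 0 = f n e1 1 /\ f n e1 1 = f n e2 0,
        - dL1 (f n e0) + dR0 (f n e1) - sk k * dL1 (f n e2) = 0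
      & dR0 (f (n + 1)%R e0) - dL1 (f n e1) + dR0 (f n e2) = 0].

Definition inH (q : R -> R) (m : nat) (k : 'I_(2 * m + 1)) (lam : R[i])
    (f : fam) : Prop :=
  exists f2 : fam,
    [/\ forall n j, exists f1, W22w (f n j) f1 (f2 n j),
        L2Gamma f, L2Gamma f2, vertex_conds k f
      & forall n j, {ae leb, forall x, I01 x ->
            - f2 n j x + (q x)%:C * f n j x = lam * f n j x}].

Definition is_phi (q : R -> R) (lam : R[i]) (phi : R -> R[i]) : Prop :=
  [/\ exists f1 f2, W22w phi f1 f2 /\
        {ae leb, forall x, I01 x -> - f2 x + (q x)%:C * phi x = lam * phi x},
      phi 0 = 0 & dR0 phi = 1].

Definition psi0 (m : nat) (k : 'I_(2 * m + 1)) (phi : R -> R[i]) : fam :=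
  let c := dL1 phi in
  let eta := 1 - sk k * c ^+ 2 in
  fun n j x =>
    if eta != 0 then
      if n == 0%R then
        (if j == e0 then eta * phi x else if j == e1 then c * phi x
         else c ^+ 2 * phi x)
      else if n == (-1)%R then
        (if j == e0 then 0 else if j == e1 then - (sk k * c * phi x)
         else - phi x)
      else 0
    else
      if n == 0%R then
        (if j == e0 then 0 else if j == e1 then phi x else c * phi x)
      else 0.

Definition psin (m : nat) (k : 'I_(2 * m + 1)) (phi : R -> R[i]) (n : int)
  : fam := fun p j => psi0 k phi (p - n) j.

Definition fhat (m : nat) (k : 'I_(2 * m + 1)) (phi : R -> R[i]) (f : fam)
  (n : int) : R[i] :=
  let c := dL1 phi in
  let eta := 1 - sk k * c ^+ 2 in
  if eta != 0 then eta^-1 * dR0 (f n e0) else dR0 (f n e1).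

Definition l2Z (a : int -> R[i]) : Prop :=
  (\esum_(n in [set: int]) (nc2 (a n))%:E < +oo)%E.

Definition symsum (a : int -> R[i]) (M : nat) : R[i] :=
  \sum_(i < (2 * M + 1)%N) a (i%:Z - M%:Z).

Definition fam_add (f g : fam) : fam := fun n j x => f n j x + g n j x.
Definition fam_scale (a : R[i]) (f : fam) : fam := fun n j x => a * f n j x.

End Defs.
Arguments I01 {R}.

(* Main.v *)
Require Import Defs.
From HB Require Import structures.
From mathcomp Require Import all_boot all_order all_algebra.
From mathcomp Require Import all_classical all_reals all_analysis.
From mathcomp Require Import measurable_realfun complex.
From mathcomp Require Import zify ring lra.
Set Implicit Arguments. Unset Strict Implicit. Unset Printing Implicit Defensive.
Import Order.TTheory GRing.Theory Num.Theory.
Import numFieldNormedType.Exports.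
Import Normc.
Local Open Scope classical_set_scope.
Local Open Scope ring_scope.
Local Open Scope complex_scope.

(* A solution on one edge is determined by its Cauchy data at either end, and the
   Wronskian with [phi] is constant, so [f 0 = c * f 1] on every edge, with
   [c = phi' 1 <> 0]. Through the vertex conditions a non-zero vertex value would
   force [c ^+ 2 = s ^+ k], hence vertex values of constant modulus along the
   graph, which a Sobolev-type lower bound on one edge makes incompatible with
   [f] and [f''] being square summable. So every eigenfunction is [A n j * phi]
   on [Gamma_{n,j}], and the Kirchhoff conditions become a linear recurrence
   which recovers [A] from the coefficients [fhat]. *)

(** * Integrals on the unit interval *)

(** Since [q] is only square integrable, the equation holds almost everywhere and [f1] need not be
    differentiable at any given point. So [f] and [f1] are both treated as integrals, and uniqueness
    and the Wronskian identity come from increment estimates over short intervals rather than from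
    differentiation. The equality [c ^+ 2 = sk k] has a geometric source. Going along [Gamma_{n,1}]
    and back along [Gamma_{n,2}] closes a loop, on which a vertex value can survive only if [c ^+ 2]
    matches the phase [sk k]; going along [Gamma_{n,1}] and [Gamma_{n+1,0}] to the next cell
    involves the same factor [c ^+ 2], which is then unimodular and excludes decay. The number [eta]
    is the flux left over at a vertex by [phi] on [Gamma_{n,1}] and [c * phi] on [Gamma_{n,2}]. If
    it is zero, this loop alone is an eigenfunction; otherwise the leftover must be carried by
    [Gamma_{n,0}] and cancelled in the preceding cell. This is why the generator and the edge read
    by [fhat] depend on [eta]. *)

Section Integrals.
Variable R : realType.
Implicit Types (g h : R -> R) (a b x y : R).

(* [leb] lives on [measurableTypeR R], not on the (convertible) canonical
   measurable structure of [R] used in [L2r]; the annotation selects the former. *)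
Lemma measurable_I01 : measurable (I01 : set (measurableTypeR R)).
Proof. exact: measurable_itv. Qed.

Lemma leb_itv_lty a b : (@leb R `[a, b]%classic < +oo)%E.
Proof.
by rewrite /leb lebesgue_measure_itv; case: ifP => _ //=; rewrite -EFinB ltry.
Qed.

Lemma integrable_cst_itv a b (r : R) :
  (@leb R).-integrable `[a, b] (EFin \o cst r).
Proof.
apply: measurable_bounded_integrable => //; first exact: leb_itv_lty.
by exists `|r|; split => // t rt s _ /=; exact: ltW.
Qed.

Lemma L2r_integrable_sqr g : L2r g ->
  (@leb R).-integrable I01 (EFin \o (fun x => g x ^+ 2)).
Proof.
move=> [mg ig]; apply/integrableP; split.
  by apply/measurable_EFinP; exact: measurable_funX.
rewrite (le_lt_trans _ ig)// le_eqVlt; apply/orP; left; apply/eqP.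
by apply: eq_integral => x _ /=; rewrite ger0_norm// sqr_ge0.
Qed.

(** The majorant is [1 + g ^+ 2], integrable because the interval has finite measure. *)
Lemma L2r_integrable g : L2r g -> (@leb R).-integrable I01 (EFin \o g).
Proof.
move=> Lg; have [mg _] := Lg.
have i1 : (@leb R).-integrable I01 (EFin \o cst 1) by exact: integrable_cst_itv.
apply: (@le_integrable _ _ _ (@leb R) _ measurable_I01 _
    (fun x => (cst 1 x)%:E + (g x ^+ 2)%:E)%E) => //.
- exact/measurable_EFinP.
- move=> x _ /=; rewrite lee_fin [leRHS]ger0_norm ?addr_ge0 ?sqr_ge0//.
  by rewrite -real_normK ?num_real//; have := normr_ge0 (g x); nra.
- exact: (integrableD measurable_I01 i1 (L2r_integrable_sqr Lg)).
Qed.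

Lemma sub_I01 x y : 0 <= x -> y <= 1 -> `[x, y]%classic `<=` @I01 R.
Proof.
move=> x0 y1 t; rewrite /I01/= !in_itv/= => /andP[xt ty].
by rewrite (le_trans x0 xt) (le_trans ty y1).
Qed.

Lemma integrable_sub x y (f : R -> \bar R) : 0 <= x -> y <= 1 ->
  (@leb R).-integrable I01 f -> (@leb R).-integrable `[x, y] f.
Proof.
move=> x0 y1; apply: integrableS; last exact: sub_I01.
- exact: measurable_I01.
- exact: measurable_itv.
Qed.

Lemma Rintegral_sub g x y : (@leb R).-integrable I01 (EFin \o g) ->
  0 <= x -> x <= y -> y <= 1 ->
  Rintegral (@leb R) `[0, y] g - Rintegral (@leb R) `[0, x] g
  = Rintegral (@leb R) `[x, y] g.
Proof.
move=> ig x0 xy y1.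
have iy : (@leb R).-integrable `[0, y] (EFin \o g) by exact: integrable_sub.
have ixy : (@leb R).-integrable `[x, y] (EFin \o g) by exact: integrable_sub.
rewrite /leb (Rintegral_itvB iy) ?bnd_simp// Rintegral_itv_obnd_cbnd//.
apply: integrableS ixy => //.
by move=> t; rewrite /= !in_itv/= => /andP[/ltW -> ->].
Qed.

Lemma within_continuous_Rintegral g : (@leb R).-integrable I01 (EFin \o g) ->
  {within I01, continuous (fun x => Rintegral (@leb R) `[0, x] g)}.
Proof. by move=> ig; apply: parameterized_integral_continuous. Qed.

(** Domination is asked only almost everywhere because the differential equation controls [f2] only
    almost everywhere. *)
Lemma le_Rintegral_ae g h x y :
  (@leb R).-integrable I01 (EFin \o g) -> (@leb R).-integrable I01 (EFin \o h) ->
  0 <= x -> y <= 1 -> (forall t, 0 <= h t) ->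
  {ae @leb R, forall t, `[x, y]%classic t -> `|g t| <= h t} ->
  `|Rintegral (@leb R) `[x, y] g| <= Rintegral (@leb R) `[x, y] h.
Proof.
move=> ig ih x0 y1 h0 gh.
have igs := integrable_sub x0 y1 ig.
have ihs := integrable_sub x0 y1 ih.
have mxy : measurable (`[x, y]%classic : set (measurableTypeR R)).
  exact: measurable_itv.
apply: (le_trans (le_normr_Rintegral mxy igs)).
have ins := integrable_norm igs.
rewrite /Rintegral; apply: fine_le.
- exact: integrable_fin_num ins.
- exact: integrable_fin_num ihs.
- apply: ae_ge0_le_integral => //.
  + exact: (measurable_int _ ins).
  + by move=> t _; rewrite lee_fin.
  + exact: (measurable_int _ ihs).
Qed.
End Integrals.

(** * Complex integrals *)

Section ComplexNumbers.
Variable R : realType.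
Implicit Types z w : R[i].

Lemma ReD z w : complex.Re (z + w) = complex.Re z + complex.Re w.
Proof. by case: z w => [? ?] [? ?]. Qed.
Lemma ImD z w : complex.Im (z + w) = complex.Im z + complex.Im w.
Proof. by case: z w => [? ?] [? ?]. Qed.
Lemma ReN z : complex.Re (- z) = - complex.Re z. Proof. by case: z. Qed.
Lemma ImN z : complex.Im (- z) = - complex.Im z. Proof. by case: z. Qed.
Lemma ReM z w : complex.Re (z * w) =
  complex.Re z * complex.Re w - complex.Im z * complex.Im w.
Proof. by case: z w => [? ?] [? ?]. Qed.
Lemma ImM z w : complex.Im (z * w) =
  complex.Re z * complex.Im w + complex.Im z * complex.Re w.
Proof. by case: z w => [? ?] [? ?]. Qed.

Definition ReImE := (ReD, ImD, ReN, ImN, ReM, ImM).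

Lemma eqC z w : complex.Re z = complex.Re w -> complex.Im z = complex.Im w ->
  z = w.
Proof. by case: z w => [? ?] [? ?] /= -> ->. Qed.

Lemma normc_ge0 z : 0 <= normc z.
Proof. by case: z => a b; rewrite /normc sqrtr_ge0. Qed.

Lemma sqr_normc z : normc z ^+ 2 = nc2 z.
Proof. by case: z => a b; rewrite /nc2 sqr_sqrtr// addr_ge0// sqr_ge0. Qed.

Lemma nc2_ge0 z : 0 <= nc2 z.
Proof. by rewrite addr_ge0// sqr_ge0. Qed.

Lemma nc2M z w : nc2 (z * w) = nc2 z * nc2 w.
Proof. by rewrite -!sqr_normc normcM exprMn. Qed.

Lemma Re_le_normc z : `|complex.Re z| <= normc z.
Proof.
rewrite -(@ler_pXn2r _ 2)// ?nnegrE ?normc_ge0// real_normK ?num_real//.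
by rewrite sqr_normc /nc2 lerDl sqr_ge0.
Qed.

Lemma Im_le_normc z : `|complex.Im z| <= normc z.
Proof.
rewrite -(@ler_pXn2r _ 2)// ?nnegrE ?normc_ge0// real_normK ?num_real//.
by rewrite sqr_normc /nc2 lerDr sqr_ge0.
Qed.

Lemma normc_le_ReIm z : normc z <= `|complex.Re z| + `|complex.Im z|.
Proof.
rewrite -(@ler_pXn2r _ 2)// ?nnegrE ?normc_ge0 ?addr_ge0//.
rewrite sqr_normc /nc2 -(real_normK (num_real (complex.Re z))).
rewrite -(real_normK (num_real (complex.Im z))).
by have := normr_ge0 (complex.Re z); have := normr_ge0 (complex.Im z); nra.
Qed.

Lemma normc_triangle z w : normc (z + w) <= normc z + normc w.
Proof. exact: le_normcD. Qed.

Lemma normc_opp z : normc (- z) = normc z.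
Proof. exact: normcN. Qed.

Lemma le_normcB z w : normc (z - w) <= normc z + normc w.
Proof. by rewrite -(normc_opp w); exact: normc_triangle. Qed.

Lemma normc_real (r : R) : normc r%:C = `|r|.
Proof. by rewrite /normc/= expr0n/= addr0 sqrtr_sqr. Qed.

Lemma normc_eq0 z : (normc z == 0) = (z == 0).
Proof. by apply/eqP/eqP => [/eq0_normc//|->]; rewrite normc0. Qed.

Lemma nc2D z w : nc2 (z + w) <= 2 * (nc2 z + nc2 w).
Proof.
rewrite /nc2 !ReImE.
have := sqr_ge0 (complex.Re z - complex.Re w).
have := sqr_ge0 (complex.Im z - complex.Im w).
nra.
Qed.
End ComplexNumbers.

Section ComplexIntegrals.
Variable R : realType.
Implicit Types (f g : R -> R[i]) (x y : R).

Definition L1c g := (@leb R).-integrable I01 (EFin \o (fun t => complex.Re (g t)))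
  /\ (@leb R).-integrable I01 (EFin \o (fun t => complex.Im (g t))).

Lemma L2c_L1c g : L2c g -> L1c g.
Proof. by move=> [gr gi]; split; exact: L2r_integrable. Qed.

Lemma L1c_cst (z : R[i]) : L1c (fun=> z).
Proof. by split; exact: integrable_cst_itv. Qed.

Lemma integrableD_I01 (u v : R -> R) :
  (@leb R).-integrable I01 (EFin \o u) -> (@leb R).-integrable I01 (EFin \o v) ->
  (@leb R).-integrable I01 (EFin \o (fun t => u t + v t)).
Proof. by move=> iu iv; exact: (integrableD (@measurable_I01 R) iu iv). Qed.

Lemma integrableZ_I01 (a : R) (u : R -> R) :
  (@leb R).-integrable I01 (EFin \o u) ->
  (@leb R).-integrable I01 (EFin \o (fun t => a * u t)).
Proof. by move=> iu; exact: (integrableZl (@measurable_I01 R) a iu). Qed.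

Lemma L1cD f g : L1c f -> L1c g -> L1c (fun t => f t + g t).
Proof.
move=> [fr fi] [gr gi]; split.
- by under [fun t => complex.Re _]eq_fun do rewrite ReD; exact: integrableD_I01.
- by under [fun t => complex.Im _]eq_fun do rewrite ImD; exact: integrableD_I01.
Qed.

Lemma L1cZ (a : R[i]) g : L1c g -> L1c (fun t => a * g t).
Proof.
move=> [gr gi]; split.
- under [fun t => complex.Re _]eq_fun do rewrite ReM -mulNr.
  by apply: integrableD_I01; exact: integrableZ_I01.
- under [fun t => complex.Im _]eq_fun do rewrite ImM.
  by apply: integrableD_I01; exact: integrableZ_I01.
Qed.

Lemma cint_sub g x y : L1c g -> 0 <= x -> x <= y -> y <= 1 ->
  cint g 0 y - cint g 0 x = cint g x y.
Proof.
move=> [gr gi] x0 xy y1.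
by apply: eqC; rewrite !ReImE/= Rintegral_sub.
Qed.

Lemma measurable_itvcc x y : measurable (`[x, y]%classic : set (measurableTypeR R)).
Proof. exact: measurable_itv. Qed.

Lemma cintD f g x y : L1c f -> L1c g -> 0 <= x -> y <= 1 ->
  cint (fun t => f t + g t) x y = cint f x y + cint g x y.
Proof.
move=> [fr fi] [gr gi] x0 y1; apply: eqC; rewrite !ReImE/=.
- under [fun t => complex.Re _]eq_fun do rewrite ReD.
  by apply: RintegralD; [exact: measurable_itvcc|exact: integrable_sub..].
- under [fun t => complex.Im _]eq_fun do rewrite ImD.
  by apply: RintegralD; [exact: measurable_itvcc|exact: integrable_sub..].
Qed.

Lemma cintZ (a : R[i]) g x y : L1c g -> 0 <= x -> y <= 1 ->
  cint (fun t => a * g t) x y = a * cint g x y.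
Proof.
move=> [gr gi] x0 y1; have mxy := measurable_itvcc x y.
have gr' := integrable_sub x0 y1 gr; have gi' := integrable_sub x0 y1 gi.
have Zr (c : R) : (@leb R).-integrable `[x, y]
    (EFin \o (fun t => c * complex.Re (g t))).
  by apply: integrable_sub => //; exact: integrableZ_I01.
have Zi (c : R) : (@leb R).-integrable `[x, y]
    (EFin \o (fun t => c * complex.Im (g t))).
  by apply: integrable_sub => //; exact: integrableZ_I01.
apply: eqC; rewrite !ReImE/=.
- under [fun t => complex.Re _]eq_fun do rewrite ReM.
  by rewrite -!RintegralZl// -RintegralB.
- under [fun t => complex.Im _]eq_fun do rewrite ImM.
  by rewrite -!RintegralZl// -RintegralD.
Qed.

Lemma cint_cst (z : R[i]) x y : x <= y -> cint (fun=> z) x y = (y - x)%:C * z.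
Proof.
move=> xy; have mxy := measurable_itvcc x y.
have lxy : fine (@leb R `[x, y]%classic) = y - x.
  rewrite /leb lebesgue_measure_itv/= lte_fin.
  by move: xy; rewrite le_eqVlt => /predU1P[->|->]//=; rewrite ltxx subrr.
by apply: eqC; rewrite !ReImE/= Rintegral_cst// lxy mul0r ?subr0 ?addr0 mulrC.
Qed.

#[global] Instance ae_leb_filter : Filter (almost_everywhere (@leb R)).
Proof. exact: ae_filter_ringOfSetsType. Qed.

(** The factor 2 comes from bounding the real and imaginary parts separately; it propagates to all
    later constants. *)
Lemma normc_cint_le g (h : R -> R) x y :
  L1c g -> (@leb R).-integrable I01 (EFin \o h) ->
  0 <= x -> y <= 1 -> (forall t, 0 <= h t) ->
  {ae @leb R, forall t, `[x, y]%classic t -> normc (g t) <= h t} ->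
  normc (cint g x y) <= 2 * Rintegral (@leb R) `[x, y] h.
Proof.
move=> [gr gi] ih x0 y1 h0 gh.
apply: (le_trans (normc_le_ReIm _)) => /=.
rewrite mulrDl mul1r; apply: lerD; apply: le_Rintegral_ae => //.
- by apply: filterS gh => t + xyt => /(_ xyt); exact: le_trans (Re_le_normc _).
- by apply: filterS gh => t + xyt => /(_ xyt); exact: le_trans (Im_le_normc _).
Qed.

Lemma normc_cint_le_cst g (C x y : R) :
  L1c g -> 0 <= x -> x <= y -> y <= 1 -> 0 <= C ->
  (forall t, x <= t <= y -> normc (g t) <= C) ->
  normc (cint g x y) <= 2 * C * (y - x).
Proof.
move=> Lg x0 xy y1 C0 gC.
have := @normc_cint_le g (cst C) x y Lg (integrable_cst_itv 0 1 C) x0 y1.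
have mxy := measurable_itvcc x y.
rewrite (Rintegral_cst (@leb R) mxy).
have -> : fine (@leb R `[x, y]%classic) = y - x.
  rewrite /leb lebesgue_measure_itv/= lte_fin.
  by move: xy; rewrite le_eqVlt => /predU1P[->|->]//=; rewrite ltxx subrr.
rewrite mulrA; apply => //.
by apply: nearW => t; rewrite /= in_itv/=; exact: gC.
Qed.

End ComplexIntegrals.

(** * Primitives and one-sided derivatives *)

Section Primitives.
Variable R : realType.
Implicit Types (f g : R -> R[i]) (u v : R -> R) (x y : R).

Lemma in_I01 x : I01 x = (0 <= x <= 1) :> Prop.
Proof. by rewrite /I01/= in_itv. Qed.

Lemma Rintegral_abs_continuous u (e : R) : 0 < e ->
  (@leb R).-integrable I01 (EFin \o u) ->
  exists2 d : R, 0 < d & forall x y, 0 <= x -> x <= y -> y <= 1 -> y - x < d ->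
    Rintegral (@leb R) `[x, y] u < e.
Proof.
move=> e0 iu.
(* Extension by zero turns the claim into absolute continuity of the integral on the whole line,
   evaluated on the set [[x, y]] of small measure. *)
have : (@leb R).-integrable setT (EFin \o u \_ I01).
  rewrite -restrict_EFin; apply/integrable_restrict; last by rewrite setTI.
  - exact: measurable_I01.
  - exact: measurableT.
move=> /integral_normr_continuous /(_ _ e0)[d [d0 /= ud]].
exists d => // x y x0 xy y1 yxd.
have mxy := measurable_itvcc x y.
have ixy := integrable_sub x0 y1 iu.
apply: le_lt_trans (ler_norm _) _.
apply: (le_lt_trans (le_normr_Rintegral mxy ixy)).
apply: le_lt_trans (ud `[x, y]%classic mxy _).
  rewrite le_eqVlt; apply/orP; left; apply/eqP; apply: eq_Rintegral => t.
  rewrite inE => /(sub_I01 x0 y1) It.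
  by rewrite /patch ifT// inE.
rewrite /leb lebesgue_measure_itv/= lte_fin.
by case: ifPn => _; rewrite ?lte_fin// -EFinB lte_fin.
Qed.

(** A norm equivalent to [normc] whose integrability follows at once from that of the two parts,
    with no square root involved. *)
Definition abs1 (z : R[i]) : R := `|complex.Re z| + `|complex.Im z|.

Lemma integrable_abs1 g : L1c g ->
  (@leb R).-integrable I01 (EFin \o (fun t => abs1 (g t))).
Proof.
by move=> [gr gi]; apply: integrableD_I01;
  [exact: (integrable_norm gr)|exact: (integrable_norm gi)].
Qed.

Lemma normc_cint_abs1 g x y : L1c g -> 0 <= x -> y <= 1 ->
  normc (cint g x y) <= 2 * Rintegral (@leb R) `[x, y] (fun t => abs1 (g t)).
Proof.
move=> Lg x0 y1; apply: normc_cint_le => //; first exact: integrable_abs1.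
- by move=> t; rewrite addr_ge0.
- by apply: nearW => t _; exact: normc_le_ReIm.
Qed.

(** Absolute continuity with almost everywhere derivative [g], in integrated form. A [W22w] triple
    is two such relations, so the same lemmas serve for [f] over [f1] and for [f1] over [f2]. *)
Definition primitive f g := L1c g /\ forall x, 0 <= x <= 1 -> f x = f 0 + cint g 0 x.

Lemma primitiveB f g x y : primitive f g -> 0 <= x -> x <= y -> y <= 1 ->
  f y - f x = cint g x y.
Proof.
move=> [Lg fg] x0 xy y1.
rewrite (fg y) ?(le_trans x0 xy)// (fg x) ?x0 ?(le_trans xy y1)//.
by rewrite -(cint_sub Lg x0 xy y1) opprD addrACA subrr add0r.
Qed.

Lemma primitive_unif f g (e : R) : primitive f g -> 0 < e ->
  exists2 d : R, 0 < d & forall x y, 0 <= x <= 1 -> 0 <= y <= 1 ->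
    `|y - x| < d -> normc (f y - f x) <= e.
Proof.
move=> fg e0; have [Lg _] := fg; have e2 : 0 < e / 2 by lra.
have [d d0 H] := Rintegral_abs_continuous e2 (integrable_abs1 Lg).
have K x y : 0 <= x -> x <= y -> y <= 1 -> y - x < d -> normc (f y - f x) <= e.
  move=> x0 xy y1 yxd; rewrite (primitiveB fg)//.
  by apply: (le_trans (normc_cint_abs1 Lg x0 y1)); have := H _ _ x0 xy y1 yxd; lra.
exists d => // x y /andP[x0 x1] /andP[y0 y1] xyd.
have [xy|/ltW yx] := leP x y.
  by apply: K => //; exact: le_lt_trans (ler_norm _) xyd.
rewrite -normc_opp opprB; apply: K => //.
by rewrite distrC in xyd; exact: le_lt_trans (ler_norm _) xyd.
Qed.

Lemma primitive_bounded f g : primitive f g ->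
  exists2 B : R, 0 <= B & forall x, 0 <= x <= 1 -> normc (f x) <= B.
Proof.
move=> fg; have [Lg fE] := fg; have ig := integrable_abs1 Lg.
have h0 x y : 0 <= Rintegral (@leb R) `[x, y] (fun t => abs1 (g t)).
  by apply: Rintegral_ge0 => t _; rewrite addr_ge0.
exists (normc (f 0) + 2 * Rintegral (@leb R) `[0, 1] (fun t => abs1 (g t))).
  by rewrite addr_ge0 ?normc_ge0// mulr_ge0.
move=> x x01; have /andP[x0 x1] := x01; rewrite fE//.
apply: (le_trans (normc_triangle _ _)); rewrite lerD2l.
apply: (le_trans (normc_cint_abs1 Lg (lexx 0) x1)); rewrite ler_pM2l//.
by rewrite -subr_ge0 Rintegral_sub.
Qed.

Lemma primitive_L1c f g : primitive f g -> L1c f.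
Proof.
move=> [Lg fE]; have [gr gi] := Lg; split.
- apply: continuous_compact_integrable; first exact: segment_compact.
  have : {within I01, continuous (fun x => complex.Re (f 0) +
      Rintegral (@leb R) `[0, x] (fun t => complex.Re (g t)))}.
    move=> x; apply: cvgD; first exact: cvg_cst.
    exact: within_continuous_Rintegral.
  apply: subspace_eq_continuous => x; rewrite inE in_I01 => x01.
  by rewrite /from_subspace (fE _ x01) ReD.
- apply: continuous_compact_integrable; first exact: segment_compact.
  have : {within I01, continuous (fun x => complex.Im (f 0) +
      Rintegral (@leb R) `[0, x] (fun t => complex.Im (g t)))}.
    move=> x; apply: cvgD; first exact: cvg_cst.
    exact: within_continuous_Rintegral.
  apply: subspace_eq_continuous => x; rewrite inE in_I01 => x01.
  by rewrite /from_subspace (fE _ x01) ImD.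
Qed.

(** [W22w] asks integrability of [f2] only; that of [f1] is deduced from its continuity as a
    primitive of [f2]. *)
Lemma W22w_primitive f f1 f2 : W22w f f1 f2 -> primitive f f1 /\ primitive f1 f2.
Proof.
move=> [L2 H]; have p12 : primitive f1 f2.
  split; first exact: L2c_L1c.
  by move=> x x01; have [|//] := H x; rewrite inE in_I01.
split=> //; split; first exact: primitive_L1c p12.
by move=> x x01; have [|//] := H x; rewrite inE in_I01.
Qed.

(** The left-hand side is the integral of [g - z]. This one estimate yields the one-sided
    derivatives, the remainders in the Wronskian and the affine approximation in [sobolev_lower]. *)
Lemma primitive_taylor f g (C x y : R) (z : R[i]) : primitive f g ->
  0 <= x -> x <= y -> y <= 1 -> 0 <= C ->
  (forall t, x <= t <= y -> normc (g t - z) <= C) ->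
  normc (f y - f x - (y - x)%:C * z) <= 2 * C * (y - x).
Proof.
move=> fg x0 xy y1 C0 gC; have [Lg _] := fg.
rewrite (primitiveB fg)// -mulrN -(cint_cst (- z) xy) -cintD//; last exact: L1c_cst.
apply: normc_cint_le_cst => //; apply: L1cD => //; exact: L1c_cst.
Qed.

Section Derivatives.
Variables f f1 f2 : R -> R[i].
Hypothesis W : W22w f f1 f2.

(** Near the end point, [f1] stays within [e / 2] of [f1 0] by uniform continuity, and the factor 2
    of [primitive_taylor] restores [e]. *)
Lemma W22w_derivable_0 (e : R) : 0 < e -> exists2 d : R, 0 < d &
  forall h, 0 < h < d -> normc ((f h - f 0) * (h^-1)%:C - f1 0) <= e.
Proof.
move=> e0; have [pf pf1] := W22w_primitive W.
have e2 : 0 < e / 2 by lra.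
have [d d0 H] := primitive_unif pf1 e2.
exists (Num.min d 1); first by rewrite lt_min d0 ltr01.
move=> h /andP[h0]; rewrite lt_min => /andP[hd h1].
have hC : (h^-1)%:C * h%:C = 1 :> R[i] by rewrite -rmorphM/= mulVf// gt_eqF.
have := @primitive_taylor f f1 (e / 2) 0 h (f1 0) pf (lexx 0) (ltW h0) (ltW h1)
  (ltW e2).
rewrite subr0 => /(_ _) T.
have -> : (f h - f 0) * h^-1%:C - f1 0 =
    (h^-1)%:C * (f h - f 0 - h%:C * f1 0) by rewrite mulrBr mulrA hC; ring.
rewrite normcM normc_real ger0_norm ?invr_ge0 ?(ltW h0)// ler_pdivrMl//.
have -> : h * e = 2 * (e / 2) * h by lra.
apply: T => t /andP[t0 th]; apply: H; rewrite ?lexx ?ler01 ?t0 ?(le_trans th (ltW h1))//.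
by rewrite subr0 ger0_norm// (le_lt_trans th).
Qed.

Lemma W22w_derivable_1 (e : R) : 0 < e -> exists2 d : R, 0 < d &
  forall h, 0 < h < d -> normc ((f 1 - f (1 - h)) * (h^-1)%:C - f1 1) <= e.
Proof.
move=> e0; have [pf pf1] := W22w_primitive W.
have e2 : 0 < e / 2 by lra.
have [d d0 H] := primitive_unif pf1 e2.
exists (Num.min d 1); first by rewrite lt_min d0 ltr01.
move=> h /andP[h0]; rewrite lt_min => /andP[hd h1].
have hC : (h^-1)%:C * h%:C = 1 :> R[i] by rewrite -rmorphM/= mulVf// gt_eqF.
have h1' : 0 <= 1 - h by rewrite subr_ge0 ltW.
have h2' : 1 - h <= 1 by rewrite gerBl ltW.
have := @primitive_taylor f f1 (e / 2) (1 - h) 1 (f1 1) pf h1' h2' (lexx 1) (ltW e2).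
rewrite subKr => /(_ _) T.
have -> : (f 1 - f (1 - h)) * h^-1%:C - f1 1 =
    (h^-1)%:C * (f 1 - f (1 - h) - h%:C * f1 1) by rewrite mulrBr mulrA hC; ring.
rewrite normcM normc_real ger0_norm ?invr_ge0 ?(ltW h0)// ler_pdivrMl//.
have -> : h * e = 2 * (e / 2) * h by lra.
apply: T => t /andP[t0 th]; apply: H; rewrite ?lexx ?ler01 ?(le_trans h1' t0)//.
by rewrite distrC ger0_norm ?subr_ge0//; lra.
Qed.

Lemma lim_at_right0 (u : R -> R) (l : R) :
  (forall e : R, 0 < e -> exists2 d : R, 0 < d &
    forall h, 0 < h < d -> `|u h - l| <= e) ->
  lim (u @ 0^'+) = l.
Proof.
move=> H; apply: cvg_lim => //; apply/cvgrPdist_le => e /H[d d0 ud].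
near=> h; rewrite distrC; apply: ud; apply/andP; split=> //.
Unshelve. all: end_near. Qed.

(** Together with [dL1_W22w], this replaces the limits in the vertex conditions by values of [f1],
    after which these conditions are plain algebra. *)
Lemma dR0_W22w : dR0 f = f1 0.
Proof.
apply: eqC => /=; apply: lim_at_right0 => e /W22w_derivable_0[d d0 H];
  exists d => // h /H; apply: le_trans.
- by apply: le_trans (Re_le_normc _); rewrite !ReImE/= mulr0 subr0.
- by apply: le_trans (Im_le_normc _); rewrite !ReImE/= mulr0 add0r.
Qed.

Lemma dL1_W22w : dL1 f = f1 1.
Proof.
apply: eqC => /=; apply: lim_at_right0 => e /W22w_derivable_1[d d0 H];
  exists d => // h /H; apply: le_trans.
- by apply: le_trans (Re_le_normc _); rewrite !ReImE/= mulr0 subr0.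
- by apply: le_trans (Im_le_normc _); rewrite !ReImE/= mulr0 add0r.
Qed.
End Derivatives.
End Primitives.

(** * The Schroedinger equation on an edge *)

Section Solutions.
Variable R : realType.
Implicit Types (f g : R -> R[i]) (x y z w : R).

(* Over a uniform partition of mesh [1 / n] the increments of [W] sum up to at
   most [K / n * (G 1 - G 0)]. *)
Lemma increment_bound_cst (W : R -> R[i]) (G : R -> R) (K : R) : 0 <= K ->
  (forall x y, 0 <= x -> x <= y -> y <= 1 ->
    normc (W y - W x) <= K * (y - x) * (G y - G x)) ->
  W 1 = W 0.
Proof.
move=> K0 WG; apply/eqP; rewrite -subr_eq0 -normc_eq0 eq_le normc_ge0 andbT.
have Hn n : normc (W 1 - W 0) <= K * n.+1%:R^-1 * (G 1 - G 0).
  have n0 : 0 < n.+1%:R :> R by rewrite ltr0n.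
  have Hj j : (j <= n.+1)%N -> normc (W (j%:R / n.+1%:R) - W 0) <=
      K * n.+1%:R^-1 * (G (j%:R / n.+1%:R) - G 0).
    elim: j => [_|j IH jn]; first by rewrite mul0r !subrr normc0 mulr0.
    have := IH (ltnW jn).
    have : normc (W (j.+1%:R / n.+1%:R) - W (j%:R / n.+1%:R)) <=
        K * n.+1%:R^-1 * (G (j.+1%:R / n.+1%:R) - G (j%:R / n.+1%:R)).
      have E : j.+1%:R / n.+1%:R - j%:R / n.+1%:R = n.+1%:R^-1 :> R.
        by rewrite -mulrBl -natrB// subSnn mul1r.
      rewrite -[X in K * X]E; apply: WG.
      - by rewrite divr_ge0.
      - by rewrite ler_pM2r ?invr_gt0// ler_nat.
      - by rewrite ler_pdivrMr// mul1r ler_nat.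
    have := normc_triangle (W (j.+1%:R / n.+1%:R) - W (j%:R / n.+1%:R))
              (W (j%:R / n.+1%:R) - W 0).
    rewrite addrA subrK; move: (K * _) => k.
    move: (W (j.+1%:R / _) - W 0) (W (j%:R / _) - W 0) => a b.
    move: (G (j.+1%:R / _)) (G (j%:R / _)) => c d.
    lra.
  by have := Hj n.+1 (leqnn _); rewrite divff// gt_eqF.
rewrite leNgt; apply/negP => D0.
have L0 : 0 <= K * (G 1 - G 0).
  apply: le_trans (normc_ge0 (W 1 - W 0)) _.
  by have := WG 0 1 (lexx _) ler01 (lexx _); rewrite subr0 mulr1.
pose n := Num.truncn (K * (G 1 - G 0) / normc (W 1 - W 0)).
have : K * (G 1 - G 0) / normc (W 1 - W 0) < n.+1%:R.
  by rewrite truncnS_gt.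
have := Hn n; rewrite mulrAC ler_pdivlMr ?ltr0n//.
by rewrite ltr_pdivrMr// mulrC => ? ?; lra.
Qed.

Variables (q : R -> R) (lam : R[i]).
Hypothesis Lq : L2r q.

Definition solves f f1 f2 := W22w f f1 f2 /\
  {ae @leb R, forall x, I01 x -> - f2 x + (q x)%:C * f x = lam * f x}.

(** A majorant of the modulus of [q - lam]. It is integrable but possibly unbounded, so increments
    of [f1] are measured by its integral and not by the length of the interval. *)
Definition weight (t : R) : R := `|q t| + normc lam.

Lemma weight_ge0 t : 0 <= weight t.
Proof. by rewrite addr_ge0// normc_ge0. Qed.

Lemma integrable_weight : (@leb R).-integrable I01 (EFin \o weight).
Proof.
apply: integrableD_I01; last exact: integrable_cst_itv.
exact: (integrable_norm (L2r_integrable Lq)).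
Qed.

Lemma normc_weight t (z : R[i]) : normc ((q t)%:C * z - lam * z) <= weight t * normc z.
Proof.
rewrite -mulrBl normcM ler_wpM2r ?normc_ge0//.
by rewrite (le_trans (le_normcB _ _))// normc_real.
Qed.


Lemma solves_normc_f2 f f1 f2 : solves f f1 f2 ->
  {ae @leb R, forall x, I01 x -> normc (f2 x) <= weight x * normc (f x)}.
Proof.
move=> [_ E]; apply: filterS E => t + It => /(_ It) Et.
have -> : f2 t = (q t)%:C * f t - lam * f t by rewrite -Et; ring.
exact: normc_weight.
Qed.

Lemma solves_incr f f1 f2 B x y : solves f f1 f2 -> 0 <= x -> x <= y -> y <= 1 ->
  0 <= B -> (forall t, x <= t <= y -> normc (f t) <= B) ->
  normc (f1 y - f1 x) <= 2 * (B * Rintegral (@leb R) `[x, y] weight).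
Proof.
move=> fs x0 xy y1 B0 fB; have [W _] := fs; have [_ pf1] := W22w_primitive W.
rewrite (primitiveB pf1)//; have [L2 _] := pf1.
have mxy := measurable_itvcc x y.
rewrite -(RintegralZl B mxy (integrable_sub x0 y1 integrable_weight)).
apply: normc_cint_le => //.
- exact: (integrableZ_I01 B integrable_weight).
- by move=> t; rewrite mulr_ge0 ?weight_ge0.
- apply: filterS (solves_normc_f2 fs) => t H xyt.
  apply: le_trans (H (sub_I01 x0 y1 xyt)) _.
  rewrite mulrC ler_wpM2r ?weight_ge0//; apply: fB.
  by move: xyt; rewrite /= in_itv.
Qed.

Lemma primitive_incr f g (B x y : R) : primitive f g ->
  0 <= x -> x <= y -> y <= 1 -> 0 <= B ->
  (forall t, x <= t <= y -> normc (g t) <= B) ->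
  normc (f y - f x) <= 2 * B * (y - x).
Proof.
by move=> fg x0 xy y1 B0 gB; have [Lg _] := fg; rewrite (primitiveB fg)//;
  exact: normc_cint_le_cst.
Qed.

(* On a short interval around [z], any common bound for [f] and [f1] can be halved. *)
Lemma zero_data_local : exists2 d : R, 0 < d & forall f f1 f2 z w,
  solves f f1 f2 -> 0 <= z <= 1 -> 0 <= w <= 1 -> `|w - z| < d ->
  f z = 0 -> f1 z = 0 -> f w = 0 /\ f1 w = 0.
Proof.
(* The length of the interval and the integral of [weight] over it both stay below 1/4, so that,
   with the factor 2 of the estimates, increments are at most half of the common bound. The radius
   depends on [weight] alone, which lets [zero_data] reuse it from point to point. *)
have e0 : 0 < 1 / 4 :> R by lra.
have [d d0 Hd] := Rintegral_abs_continuous e0 integrable_weight.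
exists (Num.min d (1 / 4)); first by rewrite lt_min d0.
move=> f f1 f2 z w fs /andP[z0 z1] w01 wz fz f1z.
have [W _] := fs; have [pf pf1] := W22w_primitive W.
have [B1 B10 HB1] := primitive_bounded pf.
have [B2 B20 HB2] := primitive_bounded pf1.
have step B x y : 0 <= B -> 0 <= x -> x <= y -> y <= 1 ->
    y - x < Num.min d (1 / 4) ->
    (forall t, x <= t <= y -> normc (f t) <= B /\ normc (f1 t) <= B) ->
    normc (f y - f x) <= B / 2 /\ normc (f1 y - f1 x) <= B / 2.
  move=> B0 x0 xy y1; rewrite lt_min => /andP[yxd yx4] fB; split.
    apply: le_trans (primitive_incr pf x0 xy y1 B0 _) _.
      by move=> t /fB[].
    have : 0 <= y - x by rewrite subr_ge0.
    nra.
  apply: le_trans (solves_incr fs x0 xy y1 B0 _) _; first by move=> t /fB[].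
  have := Hd _ _ x0 xy y1 yxd.
  nra.
(* Points between [z] and [w] are no farther from [z] than [w], so the previous bound holds on the
   whole segment; as the data vanish at [z], the halved increment is the value at [w] itself. *)
have iter n : forall w, 0 <= w <= 1 -> `|w - z| < Num.min d (1 / 4) ->
    normc (f w) <= (B1 + B2) / 2 ^+ n /\ normc (f1 w) <= (B1 + B2) / 2 ^+ n.
  elim: n => [|n IH] {w01 wz}w w01 wz.
    by rewrite expr0 divr1; have := HB1 _ w01; have := HB2 _ w01; split; lra.
  have B0 : 0 <= (B1 + B2) / 2 ^+ n by rewrite divr_ge0 ?addr_ge0// exprn_ge0.
  rewrite exprSr invfM mulrA; have /andP[w0 w1] := w01.
  have [zw|/ltW wz'] := leP z w.
    have [] := step _ z w B0 z0 zw w1 (le_lt_trans (ler_norm _) wz).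
      move=> t /andP[zt tw]; apply: IH; first by rewrite (le_trans z0)// (le_trans tw).
      by apply: le_lt_trans wz; rewrite !ger0_norm ?subr_ge0// lerD2r.
    by rewrite fz f1z !subr0.
  have wz2 : z - w < Num.min d (1 / 4).
    by apply: le_lt_trans wz; rewrite distrC ler_norm.
  have [] := step _ w z B0 w0 wz' z1 wz2.
    move=> t /andP[wt tz]; apply: IH; first by rewrite (le_trans w0)// (le_trans tz).
    apply: le_lt_trans wz; rewrite ![`|_ - z|]distrC !ger0_norm ?subr_ge0//.
    by rewrite lerD2l lerN2.
  by rewrite fz f1z !sub0r !normc_opp.
have zeroP (a : R) : 0 <= a -> (forall n, a <= (B1 + B2) / 2 ^+ n) -> a = 0.
  move=> a0 H; apply/eqP; rewrite eq_le a0 andbT leNgt; apply/negP => a1.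
  have BB0 : 0 <= B1 + B2 by rewrite addr_ge0.
  pose n := (Num.truncn ((B1 + B2) / a)).+1; have := H n.
  have : (B1 + B2) / a < n%:R by rewrite /n truncnS_gt.
  have : n%:R <= 2 ^+ n :> R by rewrite -natrX ler_nat ltnW// ltn_expl.
  rewrite ltr_pdivrMr// ler_pdivlMr ?exprn_gt0// => h1 h2 h3.
  have : n%:R * a <= 2 ^+ n * a by rewrite ler_pM2r.
  by move: (2 ^+ n) (n%:R) h1 h2 h3 => u v ? ? ? ?; lra.
split; apply/eqP; rewrite -normc_eq0; apply/eqP; apply: zeroP (normc_ge0 _) _ => n.
- by have [] := iter n _ w01 wz.
- by have [] := iter n _ w01 wz.
Qed.

Lemma zero_data f f1 f2 z w : solves f f1 f2 -> 0 <= z <= 1 -> 0 <= w <= 1 ->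
  f z = 0 -> f1 z = 0 -> f w = 0 /\ f1 w = 0.
Proof.
move=> fs z01 w01 fz f1z; have [d d0 Hd] := zero_data_local.
have H n : forall w, 0 <= w <= 1 -> `|w - z| <= n%:R * (d / 2) ->
    f w = 0 /\ f1 w = 0.
  elim: n => [|n IH] {w01}w w01.
    by rewrite mul0r normr_le0 subr_eq0 => /eqP ->.
  have n0 : 0 < n.+1%:R :> R by rewrite ltr0n.
  (* The point [v] divides the way from [z] to [w] in proportion [n] to 1: the induction hypothesis
     reaches [v], and the last piece has length at most [d / 2], hence less than [d]. *)
  move=> wz; pose r := n%:R / n.+1%:R : R; pose v := z + (w - z) * r.
  have r0 : 0 <= r by rewrite divr_ge0.
  have r1 : r <= 1 by rewrite ler_pdivrMr// mul1r ler_nat.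
  have v01 : 0 <= v <= 1.
    by move: z01 w01 => /andP[? ?] /andP[? ?]; rewrite /v; apply/andP; split; nra.
  have vz : `|v - z| <= n%:R * (d / 2).
    have rE : n.+1%:R * r = n%:R by rewrite /r mulrC divfK// gt_eqF.
    by rewrite /v [z + _]addrC addrK normrM (ger0_norm r0) -rE mulrAC ler_wpM2r.
  have [fv f1v] := IH v v01 vz.
  apply: (Hd f f1 f2 v w fs v01 w01 _ fv f1v).
  have -> : w - v = (w - z) / n.+1%:R.
    have : r + n.+1%:R^-1 = 1.
      by rewrite /r -[X in _ + X]mul1r -mulrDl natr1 divff// gt_eqF.
    by rewrite /v => E; rewrite -[X in _ = (w - z) * X](addKr r) E; ring.
  rewrite normrM (@ger0_norm _ n.+1%:R^-1) ?invr_ge0// ltr_pdivrMr//.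
  by apply: le_lt_trans wz _; rewrite mulrC ltr_pM2r//; lra.
apply: (H (Num.truncn (2 / d)).+1 _ w01).
apply: (@le_trans _ _ 1).
  by move: z01 w01 => /andP[? ?] /andP[? ?]; rewrite ler_norml; apply/andP; split; lra.
have := truncnS_gt (2 / d); rewrite ltr_pdivrMr//.
by move: ((Num.truncn _).+1%:R) => u; lra.
Qed.

(** Formally, the derivative [f * g2 - f2 * g] vanishes because both functions solve the same
    equation. Here the increment over [[x, y]] is instead shown to be at most a constant times
    [(y - x)] times the integral of [weight], a quantity of second order that [increment_bound_cst]
    sums to zero. *)
Lemma wronskian_cst f f1 f2 g g1 g2 : solves f f1 f2 -> solves g g1 g2 ->
  f 1 * g1 1 - f1 1 * g 1 = f 0 * g1 0 - f1 0 * g 0.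
Proof.
move=> fs gs; have [Wf Ef] := fs; have [Wg Eg] := gs.
have [pf pf1] := W22w_primitive Wf; have [pg pg1] := W22w_primitive Wg.
have [L2f _] := pf1; have [L2g _] := pg1.
have [b1 b10 H1] := primitive_bounded pf.
have [b2 b20 H2] := primitive_bounded pf1.
have [b3 b30 H3] := primitive_bounded pg.
have [b4 b40 H4] := primitive_bounded pg1.
pose B := b1 + b2 + b3 + b4.
have B0 : 0 <= B by rewrite /B; lra.
pose G y := Rintegral (@leb R) `[0, y] weight.
(* Of the constant 16, the term [D] below accounts for 8 and each of the remainders [r] and [s] for
   4. *)
apply: (@increment_bound_cst (fun x => f x * g1 x - f1 x * g x) G (16 * B ^+ 2)).
  by rewrite mulr_ge0// sqr_ge0.
move=> x y x0 xy y1; rewrite /G (Rintegral_sub integrable_weight)//.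
set P := Rintegral _ _ _.
have P0 : 0 <= P by apply: Rintegral_ge0 => t _; exact: weight_ge0.
have xyE t : x <= t <= y -> 0 <= t <= 1.
  by move=> /andP[xt ty]; rewrite (le_trans x0 xt) (le_trans ty y1).
have fB t : x <= t <= y -> normc (f t) <= B by move=> /xyE/H1; rewrite /B; lra.
have f1B t : x <= t <= y -> normc (f1 t) <= B by move=> /xyE/H2; rewrite /B; lra.
have gB t : x <= t <= y -> normc (g t) <= B by move=> /xyE/H3; rewrite /B; lra.
have g1B t : x <= t <= y -> normc (g1 t) <= B by move=> /xyE/H4; rewrite /B; lra.
have xx : x <= x <= y by rewrite lexx.
have yx0 : 0 <= y - x by rewrite subr_ge0.
set r := f y - f x - (y - x)%:C * f1 x.
set s := g y - g x - (y - x)%:C * g1 x.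
have C0 : 0 <= 2 * (B * P) by rewrite !mulr_ge0.
have hr : normc r <= 2 * (2 * (B * P)) * (y - x).
  apply: (primitive_taylor pf) => // t /andP[xt ty].
  apply: le_trans (solves_incr fs x0 xt (le_trans ty y1) B0 _) _.
    by move=> u /andP[xu ut]; apply: fB; rewrite xu (le_trans ut).
  rewrite ler_pM2l// ler_wpM2l// /P -subr_ge0.
  rewrite -(Rintegral_sub integrable_weight x0 xy y1).
  rewrite -(Rintegral_sub integrable_weight x0 xt (le_trans ty y1)).
  rewrite opprB addrA subrK (Rintegral_sub integrable_weight (le_trans x0 xt) ty y1).
  by apply: Rintegral_ge0 => u _; exact: weight_ge0.
have hs : normc s <= 2 * (2 * (B * P)) * (y - x).
  apply: (primitive_taylor pg) => // t /andP[xt ty].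
  apply: le_trans (solves_incr gs x0 xt (le_trans ty y1) B0 _) _.
    by move=> u /andP[xu ut]; apply: gB; rewrite xu (le_trans ut).
  rewrite ler_pM2l// ler_wpM2l// /P -subr_ge0.
  rewrite -(Rintegral_sub integrable_weight x0 xy y1).
  rewrite -(Rintegral_sub integrable_weight x0 xt (le_trans ty y1)).
  rewrite opprB addrA subrK (Rintegral_sub integrable_weight (le_trans x0 xt) ty y1).
  by apply: Rintegral_ge0 => u _; exact: weight_ge0.
pose D := cint (fun t => f y * g2 t + - g y * f2 t) x y.
have DE : D = f y * (g1 y - g1 x) - g y * (f1 y - f1 x).
  rewrite /D cintD//; try exact: L1cZ.
  by rewrite !cintZ// -(primitiveB pf1)// -(primitiveB pg1)// mulNr.
have hD : normc D <= 2 * (4 * B ^+ 2 * (y - x) * P).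
  have K0 : 0 <= 4 * B ^+ 2 * (y - x) by rewrite !mulr_ge0// sqr_ge0.
  rewrite /P -(RintegralZl _ (measurable_itvcc x y)
                 (integrable_sub x0 y1 integrable_weight)).
  apply: normc_cint_le => //.
  - by apply: L1cD; exact: L1cZ.
  - exact: (integrableZ_I01 _ integrable_weight).
  - by move=> t; rewrite mulr_ge0 ?weight_ge0.
  - apply: filterS2 Ef Eg => t Eft Egt xyt.
    have It := sub_I01 x0 y1 xyt; move/(_ It) : Eft => Eft; move/(_ It) : Egt => Egt.
    have {xyt} : x <= t <= y by move: xyt; rewrite /= in_itv.
    move=> xyt; have /andP[xt ty] := xyt.
    have f2E : f2 t = (q t)%:C * f t - lam * f t by rewrite -Eft; ring.
    have g2E : g2 t = (q t)%:C * g t - lam * g t by rewrite -Egt; ring.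
    have -> : f y * g2 t + - g y * f2 t =
        (q t)%:C * ((f y - f t) * g t - (g y - g t) * f t)
        - lam * ((f y - f t) * g t - (g y - g t) * f t).
      by rewrite f2E g2E; ring.
    apply: le_trans (normc_weight _ _) _.
    rewrite mulrC ler_wpM2r ?weight_ge0//.
    apply: le_trans (le_normcB _ _) _; rewrite !normcM.
    have t0 := le_trans x0 xt.
    have ft : normc (f y - f t) <= 2 * B * (y - x).
      apply: le_trans (primitive_incr pf t0 ty y1 B0 _) _.
        by move=> u /andP[tu uy]; apply: f1B; rewrite (le_trans xt tu).
      by rewrite ler_wpM2l ?mulr_ge0// lerD2l lerN2.
    have gt : normc (g y - g t) <= 2 * B * (y - x).
      apply: le_trans (primitive_incr pg t0 ty y1 B0 _) _.
        by move=> u /andP[tu uy]; apply: g1B; rewrite (le_trans xt tu).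
      by rewrite ler_wpM2l ?mulr_ge0// lerD2l lerN2.
    have M1 := ler_pM (normc_ge0 _) (normc_ge0 _) ft (gB _ xyt).
    have M2 := ler_pM (normc_ge0 _) (normc_ge0 _) gt (fB _ xyt).
    apply: le_trans (lerD M1 M2) _.
    by rewrite expr2 le_eqVlt; apply/orP; left; apply/eqP; ring.
have -> : f y * g1 y - f1 y * g y - (f x * g1 x - f1 x * g x) =
    D + (r * g1 x - s * f1 x) by rewrite DE /r /s; ring.
apply: le_trans (normc_triangle _ _) _.
have := le_normcB (r * g1 x) (s * f1 x); rewrite !normcM.
have M1 := ler_pM (normc_ge0 _) (normc_ge0 _) hr (g1B _ xx).
have M2 := ler_pM (normc_ge0 _) (normc_ge0 _) hs (f1B _ xx).
move: M1 M2 hD; rewrite expr2 => M1 M2 hD M3.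
apply: le_trans (lerD hD (le_trans M3 (lerD M1 M2))) _.
by rewrite le_eqVlt; apply/orP; left; apply/eqP; ring.
Qed.

End Solutions.

(** * Square-integrable functions *)

Section SquareIntegrable.
Variable R : realType.
Implicit Types (f g : R -> R[i]) (u v : R -> R).

Lemma integrable_sqr_L2r u : measurable_fun (I01 : set (measurableTypeR R)) u ->
  (@leb R).-integrable I01 (EFin \o (fun x => u x ^+ 2)) -> L2r u.
Proof.
move=> mu iu; split; first exact: mu.
have /integrableP[_] := iu; apply: le_lt_trans.
rewrite le_eqVlt; apply/orP; left; apply/eqP; apply: eq_integral => x _ /=.
by rewrite ger0_norm// sqr_ge0.
Qed.

Lemma L2r_measurable u : L2r u -> measurable_fun (I01 : set (measurableTypeR R)) u.
Proof. by case. Qed.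

Lemma L2rD u v : L2r u -> L2r v -> L2r (fun x => u x + v x).
Proof.
move=> Lu Lv.
have m : measurable_fun (I01 : set (measurableTypeR R)) (fun x => u x + v x).
  by apply: measurable_funD; exact: L2r_measurable.
apply: integrable_sqr_L2r => //.
have i2 := integrableZ_I01 2
  (integrableD_I01 (L2r_integrable_sqr Lu) (L2r_integrable_sqr Lv)).
apply: le_integrable i2.
- exact: measurable_I01.
- by apply/measurable_EFinP; exact: measurable_funX.
- move=> x _ /=; rewrite lee_fin (ger0_norm (sqr_ge0 _)).
  apply: le_trans (ler_norm _).
  by have := sqr_ge0 (u x - v x); nra.
Qed.

Lemma L2rZ (a : R) u : L2r u -> L2r (fun x => a * u x).
Proof.
move=> Lu; apply: integrable_sqr_L2r.
  by apply: measurable_funM => //; exact: L2r_measurable.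
by under [fun x => _ ^+ 2]eq_fun do rewrite exprMn;
  exact: integrableZ_I01 (L2r_integrable_sqr Lu).
Qed.

Lemma L2cD f g : L2c f -> L2c g -> L2c (fun x => f x + g x).
Proof.
move=> [fr fi] [gr gi]; split.
- by under [fun x => complex.Re _]eq_fun do rewrite ReD; exact: L2rD.
- by under [fun x => complex.Im _]eq_fun do rewrite ImD; exact: L2rD.
Qed.

Lemma L2cZ (a : R[i]) f : L2c f -> L2c (fun x => a * f x).
Proof.
move=> [fr fi]; split.
- under [fun x => complex.Re _]eq_fun do rewrite ReM -mulNr.
  by apply: L2rD; exact: L2rZ.
- under [fun x => complex.Im _]eq_fun do rewrite ImM.
  by apply: L2rD; exact: L2rZ.
Qed.

Lemma bounded_L2r u (B : R) : (@leb R).-integrable I01 (EFin \o u) ->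
  (forall x, 0 <= x <= 1 -> `|u x| <= B) -> L2r u.
Proof.
move=> iu uB.
have m : measurable_fun (I01 : set (measurableTypeR R)) u.
  by apply/measurable_EFinP; exact: (measurable_int _ iu).
apply: integrable_sqr_L2r => //.
apply: le_integrable (integrable_cst_itv 0 1 (B ^+ 2)).
- exact: measurable_I01.
- by apply/measurable_EFinP; exact: measurable_funX.
- move=> x Ix; have {Ix}/uB xB /= : 0 <= x <= 1 by rewrite -in_I01.
  rewrite lee_fin !ger0_norm ?sqr_ge0// -real_normK ?num_real//.
  by rewrite ler_pXn2r// nnegrE// (le_trans _ xB).
Qed.

Lemma primitive_L2c f g : primitive f g -> L2c f.
Proof.
move=> pf; have [fr fi] := primitive_L1c pf.
have [B B0 fB] := primitive_bounded pf.
by split; apply: (@bounded_L2r _ B) => // x /fB; apply: le_trans;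
  [exact: Re_le_normc|exact: Im_le_normc].
Qed.

Definition sqnorm f : R := Rintegral (@leb R) I01 (fun x => nc2 (f x)).

Lemma integrable_nc2 f : L2c f ->
  (@leb R).-integrable I01 (EFin \o (fun x => nc2 (f x))).
Proof. by move=> [fr fi]; apply: integrableD_I01; exact: L2r_integrable_sqr. Qed.

Lemma normL2sqE f : L2c f -> normL2sq f = (sqnorm f)%:E.
Proof.
move=> Lf; have := integrable_fin_num (@measurable_I01 R) (integrable_nc2 Lf).
by rewrite /sqnorm /Rintegral => /fineK ->.
Qed.

Lemma sqnorm_ge0 f : 0 <= sqnorm f.
Proof. by apply: Rintegral_ge0 => x _; exact: nc2_ge0. Qed.

Lemma sqnormZ (a : R[i]) f : L2c f -> sqnorm (fun x => a * f x) = nc2 a * sqnorm f.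
Proof.
move=> Lf; rewrite /sqnorm -RintegralZl; [|exact: measurable_I01|exact: integrable_nc2].
by apply: eq_Rintegral => x _; rewrite nc2M.
Qed.

Lemma sqnorm_eq0 f : L2c f -> sqnorm f = 0 ->
  {ae @leb R, forall x, I01 x -> f x = 0}.
Proof.
move=> Lf f0; have mf := measurable_int _ (integrable_nc2 Lf).
have : ae_eq (@leb R) I01 (EFin \o (fun x => nc2 (f x))) (cst 0%E).
  apply/(ae_eq_integral_abs (@leb R) (@measurable_I01 R) mf).
  rewrite -[RHS]/(0%:E) -f0 -normL2sqE//; apply: eq_integral => x _ /=.
  by rewrite ger0_norm// nc2_ge0.
apply: filterS => x + Ix => /(_ Ix)/= -[]; rewrite -sqr_normc => /eqP.
by rewrite sqrf_eq0 normc_eq0 => /eqP.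
Qed.

(** A substitute for Cauchy-Schwarz with a free parameter: [a <= e / 2 + a ^+ 2 / (2 * e)], applied
    to each of the two parts and integrated over an interval of length 1. *)
Lemma Rintegral_abs1_le f (e : R) : L2c f -> 0 < e ->
  Rintegral (@leb R) I01 (fun t => abs1 (f t)) <= e + sqnorm f / (2 * e).
Proof.
move=> Lf e0; have in2 := integrable_nc2 Lf.
have iZ := integrableZ_I01 (2 * e)^-1 in2.
have ie := integrable_cst_itv 0 1 e.
have -> : e + sqnorm f / (2 * e) =
    Rintegral (@leb R) I01 (fun t => e + (2 * e)^-1 * nc2 (f t)).
  rewrite (RintegralD (@measurable_I01 R) ie iZ).
  rewrite (RintegralZl _ (@measurable_I01 R) in2) mulrC; congr (_ + _).
  have l1 : @leb R `[0, 1]%classic = 1%E.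
    by rewrite /leb lebesgue_measure_itv/= lte_fin ltr01/= oppr0 adde0.
  rewrite (Rintegral_cst (@leb R) (@measurable_I01 R)) -[LHS]mulr1; congr (e * _).
  exact: (esym (congr1 fine l1)).
apply: le_Rintegral.
- exact: measurable_I01.
- exact: integrable_abs1 (L2c_L1c Lf).
- exact: integrableD_I01.
move=> x _; rewrite /abs1 /nc2 -(real_normK (num_real (complex.Re _))).
rewrite -(real_normK (num_real (complex.Im _))).
move: `|_| `|_| => a b.
rewrite mulrC -lerBlDl ler_pdivlMr ?mulr_gt0//.
by have := sqr_ge0 (a - e); have := sqr_ge0 (b - e); nra.
Qed.

End SquareIntegrable.

(** * Lower bounds *)

Section LowerBound.
Variable R : realType.
Implicit Types f : R -> R[i].

Lemma sqnorm_ge f (a k : R) : L2c f -> 0 <= a -> a + 1 / 4 <= 1 -> 0 <= k ->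
  (forall x, a <= x <= a + 1 / 4 -> k <= nc2 (f x)) -> k / 4 <= sqnorm f.
Proof.
move=> Lf a0 a1 k0 fk.
have mJ := measurable_itvcc a (a + 1 / 4).
have sJ := @sub_I01 R a (a + 1 / 4) a0 a1.
rewrite -lee_fin -normL2sqE//.
have in2 := integrable_nc2 Lf; have mn := measurable_int _ in2.
apply: (@le_trans _ _ (\int[@leb R]_(x in `[a, (a + 1 / 4)%R]) (nc2 (f x))%:E)%E).
  apply: (@le_trans _ _ (\int[@leb R]_(x in `[a, (a + 1 / 4)%R]) (cst k%:E x))%E).
    have lJ : @leb R `[a, a + 1 / 4]%classic = (1 / 4)%:E.
      rewrite /leb lebesgue_measure_itv/= lte_fin ltrDl ifT; last by lra.
      by rewrite -EFinB addrC addKr.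
    have := integral_cst (@leb R) mJ k%:E => ->.
    apply: (@le_trans _ _ (k%:E * (1 / 4)%:E)%E).
      by rewrite -EFinM lee_fin; lra.
    by rewrite -lJ; exact: lexx.
  apply: ge0_le_integral => //; exact: measurable_funS (@measurable_I01 R) sJ mn.
have n0 x : (@I01 R) x -> (0 <= (EFin \o (fun x => nc2 (f x))) x)%E.
  by move=> _; rewrite lee_fin nc2_ge0.
have := ge0_subset_integral (@leb R) mJ (@measurable_I01 R) mn n0 sJ.
exact.
Qed.

(* The affine part [f 0 + x * f1 0] has modulus at least [k / 2] on [0, 1/4] if
   [|f1 0| <= 2 * k], and on [3/4, 1] otherwise. *)
Lemma sobolev_lower (k : R) : 0 < k -> exists2 d : R, 0 < d &
  forall f f1 f2, W22w f f1 f2 -> L2c f -> normc (f 0) = k ->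
    d <= sqnorm f + sqnorm f2.
Proof.
(* If the sum of the norms were smaller, [Rintegral_abs1_le] with [e = k / 64] would give
   [M <= k / 32], so [f] would differ from its affine part by at most [4 * M <= k / 8]. On a quarter
   interval its modulus would then be at least [k / 2 - k / 8 = 3 * k / 8], too much for
   [sqnorm f]. *)
move=> k0; exists ((k / 64) ^+ 2); first by rewrite exprn_gt0// divr_gt0.
move=> f f1 f2 W Lf f0k; rewrite leNgt; apply/negP => Sd.
have [pf pf1] := W22w_primitive W; have [L2 _] := W.
have n1 := sqnorm_ge0 f; have n2 := sqnorm_ge0 f2.
have e0 : 0 < k / 64 by lra.
pose M := Rintegral (@leb R) `[0, 1] (fun t => abs1 (f2 t)).
have hM : M <= k / 32.
  apply: le_trans (Rintegral_abs1_le L2 e0) _.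
  have : sqnorm f2 / (2 * (k / 64)) <= k / 64.
    by rewrite ler_pdivrMr ?mulr_gt0//; nra.
  lra.
have M0 : 0 <= M by apply: Rintegral_ge0 => t _; rewrite addr_ge0.
have osc t : 0 <= t -> t <= 1 -> normc (f1 t - f1 0) <= 2 * M.
  move=> t0 t1; rewrite (primitiveB pf1)//.
  apply: le_trans (normc_cint_abs1 (L2c_L1c L2) (lexx _) t1) _.
  rewrite ler_pM2l// -subr_ge0 (Rintegral_sub (integrable_abs1 (L2c_L1c L2)))//.
  by apply: Rintegral_ge0 => u _; rewrite addr_ge0.
have lin x : 0 <= x <= 1 -> normc (f 0 + x%:C * f1 0) <= normc (f x) + k / 8.
  move=> /andP[x0 x1].
  have r : normc (f x - f 0 - (x - 0)%:C * f1 0) <= 2 * (2 * M) * (x - 0).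
    apply: (primitive_taylor pf) => //; first by rewrite mulr_ge0.
    by move=> t /andP[t0 tx]; apply: osc => //; exact: le_trans x1.
  have -> : f 0 + x%:C * f1 0 = f x - (f x - f 0 - (x - 0)%:C * f1 0).
    by rewrite subr0; ring.
  apply: le_trans (le_normcB _ _) _; rewrite lerD2l; apply: le_trans r _.
  by nra.
have fin a : 0 <= a -> a + 1 / 4 <= 1 ->
    (forall x, a <= x <= a + 1 / 4 -> k / 2 <= normc (f 0 + x%:C * f1 0)) -> False.
  move=> a0 a1 H.
  have := @sqnorm_ge f a ((3 * k / 8) ^+ 2) Lf a0 a1 (sqr_ge0 _).
  have K x : a <= x <= a + 1 / 4 -> (3 * k / 8) ^+ 2 <= nc2 (f x).
    move=> xa; rewrite -sqr_normc ler_pXn2r ?nnegrE ?normc_ge0//; last by lra.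
    have := H _ xa; have := lin x; move: xa => /andP[? ?].
    have -> : 0 <= x <= 1 by apply/andP; split; lra.
    by move=> /(_ isT); lra.
  by move=> /(_ K); nra.
have [b2|b2] := leP (normc (f1 0)) (2 * k).
- apply: (fin 0) => //; first by lra.
  move=> x /andP[x0 x1].
  have : normc (f 0) <= normc (f 0 + x%:C * f1 0) + normc (x%:C * f1 0).
    by rewrite -[X in normc X <= _](addrK (x%:C * f1 0)) le_normcB.
  rewrite f0k [normc (x%:C * _)]normcM normc_real ger0_norm//.
  by nra.
- apply: (fin (3 / 4)); [by lra|by lra|].
  move=> x /andP[x0 x1].
  have : normc (x%:C * f1 0) <= normc (f 0 + x%:C * f1 0) + normc (f 0).
    by rewrite -[X in normc X <= _](addKr (f 0)) addrC le_normcB.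
  rewrite f0k [normc (x%:C * _)]normcM normc_real ger0_norm; last by lra.
  by nra.
Qed.
End LowerBound.

(** * Divergence of sums over the integers *)

Section Sums.
Variable R : realType.
Local Open Scope ereal_scope.

Lemma esum_int_pos_lower (t : int -> \bar R) (d : R) : (0 < d)%R ->
  (forall n, d%:E <= t n) -> \esum_(n in [set: int]) t n = +oo.
Proof.
move=> d0 dt; apply/eqyP => A A0.
have t0 n : 0 <= t n by apply: le_trans (dt n); rewrite lee_fin ltW.
pose N := (Num.truncn (A / d)).+1.
(* The nonnegative half of the integers already makes the sum diverge, and there it is an ordinary
   series. *)
rewrite (esumID (range Posz))//.
apply: le_trans (leeDl _ _); last exact: esum_ge0.
rewrite setTI esum_image; last by move=> i j _ _ [].
rewrite -nneseries_esumT//.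
apply: le_trans (@nneseries_lim_ge _ (fun i => t (Posz i)) xpredT 0%N N _) => //.
apply: (@le_trans _ _ (\sum_(0 <= i < N) d%:E)); last exact: lee_sum.
rewrite sumEFin lee_fin big_const_nat subn0 iter_addr addr0.
by rewrite -mulr_natr mulrC -ler_pdivrMr// ltW// truncnS_gt.
Qed.

End Sums.

(** * Sums over the graph *)

Section GraphSums.
Variable R : realType.
Local Open Scope ereal_scope.

Lemma esum_lineE n (t : int * 'I_n -> \bar R) : (forall a, 0 <= t a) ->
  \esum_(a in [set: int * 'I_n]) t a = \esum_(p in [set: int]) \sum_(j < n) t (p, j).
Proof.
move=> t0.
rewrite [RHS](_ : _ = \esum_(p in [set: int]) \esum_(j in [set: 'I_n]) t (p, j)).
  rewrite esum_esum//.
  have -> : [set: int] `*`` (fun=> [set: 'I_n]) = [set: int * 'I_n].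
    by apply/seteqP; split=> -[].
  by apply: eq_esum => -[].
apply: eq_esum => p _; rewrite esum_fset//; last exact: finite_finset.
rewrite fsbig_seq ?index_enum_uniq//.
rewrite (_ : [set` index_enum 'I_n] = [set: 'I_n])//.
by apply/seteqP; split=> // j _; rewrite /= mem_index_enum.
Qed.

Lemma esum_column n (t : int * 'I_n -> \bar R) (j : 'I_n) : (forall a, 0 <= t a) ->
  \esum_(p in [set: int]) t (p, j) <= \esum_(a in [set: int * 'I_n]) t a.
Proof.
move=> t0; rewrite esum_lineE//; apply: le_esum => p _.
by rewrite (bigD1 j)//= leeDl// sume_ge0.
Qed.

Lemma esum_columns_lty n (t : int * 'I_n -> \bar R) : (forall a, 0 <= t a) ->
  (forall j, \esum_(p in [set: int]) t (p, j) < +oo) ->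
  \esum_(a in [set: int * 'I_n]) t a < +oo.
Proof.
move=> t0 tj; rewrite esum_lineE// esum_sum//.
by elim/big_ind: _ => // x y; exact: lte_add_pinfty.
Qed.

Lemma esumZl_le (T : choiceType) (t : T -> \bar R) (k : R) : (0 <= k)%R ->
  (forall i, 0 <= t i) ->
  \esum_(i in [set: T]) (k%:E * t i) <= k%:E * \esum_(i in [set: T]) t i.
Proof.
move=> k0 t0; apply: ge_ereal_sup => /= _ [X [finX _] <-].
rewrite -ge0_mule_fsumr//; apply: lee_wpmul2l; first by rewrite lee_fin.
by apply: esum_ge; exists X.
Qed.

Lemma esumZl_lty (T : choiceType) (t : T -> \bar R) (k : R) : (0 <= k)%R ->
  (forall i, 0 <= t i) -> \esum_(i in [set: T]) t i < +oo ->
  \esum_(i in [set: T]) (k%:E * t i) < +oo.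
Proof.
move=> k0 t0 toy; apply: le_lt_trans (esumZl_le k0 t0) _.
have := esum_ge0 (S := [set: T]) (fun i _ => t0 i); move: toy.
by case: (esum _ _) => // r _ _; rewrite -EFinM ltry.
Qed.

Lemma esum_shift (t : int -> \bar R) :
  \esum_(n in [set: int]) t (n + 1)%R = \esum_(n in [set: int]) t n.
Proof.
rewrite [RHS](@reindex_esum _ _ _ [set: int] [set: int] (fun n => (n + 1)%R))//.
split=> //.
- by move=> x y _ _ /addIr.
- by move=> y _; exists (y - 1)%R => //; rewrite subrK.
Qed.

Local Open Scope ring_scope.

(** The shape is that of [synthesis], where each cell sees two consecutive coefficients. It rests on
    [nc2D] and on shift invariance of the sum. *)
Lemma l2Z_combination (a : int -> R[i]) (z w : R[i]) : l2Z a ->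
  l2Z (fun n => z * a n + w * a (n + 1)).
Proof.
move=> la; rewrite /l2Z.
have a0 n : (0 <= (nc2 (a n))%:E)%E by rewrite lee_fin nc2_ge0.
have a1 n : (0 <= (nc2 (a (n + 1)))%:E)%E by rewrite lee_fin nc2_ge0.
have k0 u : 0 <= 2 * nc2 u :> R by rewrite mulr_ge0// nc2_ge0.
apply: (@le_lt_trans _ _ (\esum_(n in [set: int]) ((2 * nc2 z)%:E * (nc2 (a n))%:E +
    (2 * nc2 w)%:E * (nc2 (a (n + 1)))%:E))%E).
  apply: le_esum => n _; rewrite -!EFinM -EFinD lee_fin.
  by apply: le_trans (nc2D _ _) _; rewrite !nc2M; lra.
rewrite esumD; [|by move=> n _; rewrite mule_ge0// lee_fin..].
apply: lte_add_pinfty; apply: esumZl_lty => //.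
by rewrite (esum_shift (fun n => (nc2 (a n))%:E)).
Qed.

Lemma l2ZZ (a : int -> R[i]) (z : R[i]) : l2Z a -> l2Z (fun n => z * a n).
Proof.
move=> la; have := l2Z_combination z 0 la.
by under [fun n => _ + _]eq_fun do rewrite mul0r addr0.
Qed.

Lemma l2Z_delta (p : int) : l2Z (fun n => (n == p)%:R : R[i]).
Proof.
rewrite /l2Z (_ : esum _ _ = \esum_(n in [set p]) (1%:E : \bar R))%E.
  by rewrite esum_set1 ?ltry// lee_fin.
rewrite [RHS]esum_mkcond; apply: eq_esum => n _.
have [->|np] := eqVneq n p; first by rewrite mem_set// /nc2/= expr0n/= expr1n addr0.
by rewrite memNset ?/nc2/= ?expr0n/= ?addr0//; exact/eqP.
Qed.

Lemma int_shift_invariant (T : Type) (u : int -> T) :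
  (forall n, u (n + 1) = u n) -> forall n, u n = u 0.
Proof.
move=> uS; elim/int_rect => [//|n IH|n IH].
- by rewrite intS addrC uS.
- by rewrite -IH -(uS (- n.+1%:Z)) intS opprD addrAC addNr add0r.
Qed.

(** Serves the case [eta = 0], where the recurrence on the edges [Gamma_{n,0}] is multiplication by
    a unimodular number. *)
Lemma l2Z_const_normc (a : int -> R[i]) : l2Z a ->
  (forall n, normc (a (n + 1)) = normc (a n)) -> forall n, a n = 0.
Proof.
move=> la aS n; apply/eqP; rewrite -normc_eq0; apply/negP => /negP an.
have ac := int_shift_invariant aS.
have d0 : 0 < normc (a 0) ^+ 2.
  by rewrite -(ac n) exprn_gt0// lt_neqAle eq_sym an normc_ge0.
move: la; rewrite /l2Z (esum_int_pos_lower d0) ?ltxx// => p.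
by rewrite -(ac p) sqr_normc.
Qed.
End GraphSums.

(** * Eigenfunctions *)

Section Edge.
Variables (R : realType) (q : R -> R) (lam : R[i]).
Hypothesis Lq : L2r q.
Implicit Types f g : R -> R[i].

Lemma W22wD f f1 f2 g g1 g2 : W22w f f1 f2 -> W22w g g1 g2 ->
  W22w (fun x => f x + g x) (fun x => f1 x + g1 x) (fun x => f2 x + g2 x).
Proof.
move=> Wf Wg; have [[Lf1 fE] [Lf2 f1E]] := W22w_primitive Wf.
have [[Lg1 gE] [Lg2 g1E]] := W22w_primitive Wg.
split; first by apply: L2cD; [case: Wf|case: Wg].
move=> x; rewrite inE in_I01 => x01; have /andP[x0 x1] := x01.
by rewrite !cintD// fE// gE// f1E// g1E//; split; rewrite addrACA.
Qed.

Lemma W22wZ (a : R[i]) f f1 f2 : W22w f f1 f2 ->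
  W22w (fun x => a * f x) (fun x => a * f1 x) (fun x => a * f2 x).
Proof.
move=> Wf; have [[Lf1 fE] [Lf2 f1E]] := W22w_primitive Wf.
split; first by apply: L2cZ; case: Wf.
move=> x; rewrite inE in_I01 => x01; have /andP[x0 x1] := x01.
by rewrite !cintZ// fE// f1E//; split; rewrite mulrDr.
Qed.

Lemma solvesD f f1 f2 g g1 g2 : solves q lam f f1 f2 -> solves q lam g g1 g2 ->
  solves q lam (fun x => f x + g x) (fun x => f1 x + g1 x) (fun x => f2 x + g2 x).
Proof.
move=> [Wf Ef] [Wg Eg]; split; first exact: W22wD.
apply: filterS2 Ef Eg => x + + Ix => /(_ Ix) Ef /(_ Ix) Eg.
by rewrite [RHS]mulrDr -Ef -Eg; ring.
Qed.

Lemma solvesZ (a : R[i]) f f1 f2 : solves q lam f f1 f2 ->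
  solves q lam (fun x => a * f x) (fun x => a * f1 x) (fun x => a * f2 x).
Proof.
move=> [Wf Ef]; split; first exact: W22wZ.
apply: filterS Ef => x + Ix => /(_ Ix) Ef.
by rewrite [RHS]mulrCA -Ef; ring.
Qed.

Variables phi phi1 phi2 : R -> R[i].
Hypothesis phi_solves : solves q lam phi phi1 phi2.
Hypotheses (phi0 : phi 0 = 0) (phi1_0 : phi1 0 = 1) (phi_1 : phi 1 = 0).

(** Otherwise [phi] would have zero Cauchy data at 1, hence at 0, against [phi1 0 = 1]. *)
Lemma phi1_1_neq0 : phi1 1 != 0.
Proof.
apply/eqP => c0.
have l0 : 0 <= (0 : R) <= 1 by rewrite lexx ler01.
have l1 : 0 <= (1 : R) <= 1 by rewrite lexx ler01.
have [_ /eqP] := zero_data Lq phi_solves l1 l0 phi_1 c0.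
by rewrite phi1_0 oner_eq0.
Qed.

(** The two sides are the Wronskian of [f] and [phi] at the two ends, where [phi] vanishes. *)
Lemma solves_ends f f1 f2 : solves q lam f f1 f2 -> f 0 = phi1 1 * f 1.
Proof.
move=> fs; have := wronskian_cst Lq fs phi_solves.
by rewrite phi0 phi1_0 phi_1 !mulr0 !subr0 mulr1 mulrC => ->.
Qed.

(** The difference [f - f1 0 * phi] solves the equation with zero Cauchy data at 0. *)
Lemma solves_dirichlet f f1 f2 : solves q lam f f1 f2 -> f 0 = 0 ->
  forall x, 0 <= x <= 1 -> f x = f1 0 * phi x /\ f1 x = f1 0 * phi1 x.
Proof.
move=> fs f0 x x01.
have l0 : 0 <= (0 : R) <= 1 by rewrite lexx ler01.
have [] := zero_data Lq (solvesD fs (solvesZ (- f1 0) phi_solves)) l0 x01.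
- by rewrite f0 phi0 mulr0 addr0.
- by rewrite phi1_0 mulr1 addrN.
by rewrite !mulNr => /eqP + /eqP; rewrite !subr_eq0 => /eqP ? /eqP.
Qed.

Lemma phi_L2c : L2c phi.
Proof. by have [W _] := phi_solves; have [/primitive_L2c] := W22w_primitive W. Qed.

(* If [phi] vanished almost everywhere, so would [phi''], and [phi] would be
   [x], which does not vanish at [1]. *)
Lemma sqnorm_phi_gt0 : 0 < sqnorm phi.
Proof.
rewrite lt_neqAle sqnorm_ge0 andbT eq_sym; apply/eqP => n0.
have [W _] := phi_solves; have [pf pf1] := W22w_primitive W; have [L2 _] := pf1.
have z0 : {ae @leb R, forall t, `[0, 1]%classic t -> normc (phi2 t) <= 0}.
  apply: filterS2 (sqnorm_eq0 phi_L2c n0) (solves_normc_f2 phi_solves).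
  by move=> t + + It => /(_ It) -> /(_ It); rewrite normc0 mulr0.
have c1 x : 0 <= x <= 1 -> normc (phi1 x - 1) <= 0.
  move=> /andP[x0 x1]; rewrite -phi1_0 (primitiveB pf1)//.
  apply: le_trans (normc_cint_le (h := cst 0) L2 _ (lexx 0) x1 _ _) _ => //.
  - exact: integrable_cst_itv.
  - apply: filterS z0 => t + t0x; apply; move: t0x.
    by rewrite /= !in_itv/= => /andP[-> /le_trans]; apply.
  - by rewrite (Rintegral_cst (@leb R) (measurable_itvcc 0 x)) mul0r mulr0.
have := @primitive_taylor _ phi phi1 0 0 1 1 pf (lexx _) ler01 (lexx _) (lexx _) c1.
rewrite phi0 phi_1 mulr0 mul0r !subr0 sub0r mulr1 normc_opp normc1.
by rewrite ler10.
Qed.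
End Edge.

Lemma normc_sk (R : realType) (m : nat) (k : 'I_(2 * m + 1)) :
  normc (@sk R m k) = 1.
Proof.
rewrite /sk; elim: (nat_of_ord k) => [|n IH]; first by rewrite expr0 normc1.
by rewrite exprS normcM IH mulr1 /sN /normc cos2Dsin2 sqrtr1.
Qed.

Section Eigenfunctions.
Variables (R : realType) (q : R -> R) (lam : R[i]) (m : nat) (k : 'I_(2 * m + 1)).
Variables phi phi1 phi2 : R -> R[i].
Hypothesis Lq : L2r q.
Hypothesis phi_solves : solves q lam phi phi1 phi2.
Hypotheses (phi0 : phi 0 = 0) (phi1_0 : phi1 0 = 1) (phi_1 : phi 1 = 0).

Local Notation s := (@sk R m k).
Local Notation c := (phi1 1).

Lemma sk_neq0 : s != 0.
Proof. by rewrite -normc_eq0 normc_sk oner_eq0. Qed.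

Lemma ord3P (P : 'I_3 -> Prop) : P e0 -> P e1 -> P e2 -> forall j, P j.
Proof.
move=> P0 P1 P2 [[|[|[|//]]] h].
- by rewrite (_ : Ordinal h = e0)//; exact: val_inj.
- by rewrite (_ : Ordinal h = e1)//; exact: val_inj.
- by rewrite (_ : Ordinal h = e2)//; exact: val_inj.
Qed.

Lemma inH_vertices f : inH q k lam f -> forall n j, f n j 0 = 0 /\ f n j 1 = 0.
Proof.
move=> [f2 [fW [fL fsum] [f2L f2sum] V E]].
have ends n j : f n j 0 = c * f n j 1.
  by have [f1 W] := fW n j; apply: (solves_ends Lq phi_solves) => //; split; [exact: W|].
have c0 : c != 0 by exact: (phi1_1_neq0 Lq phi_solves).
have V1 n : f n e0 1 = f n e1 0 by have [[]] := V n.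
have V2 n : f n e1 0 = s * f n e2 1 by have [[]] := V n.
have V3 n : f (n + 1) e0 0 = f n e1 1 by have [_ []] := V n.
have V4 n : f n e1 1 = f n e2 0 by have [_ []] := V n.
(* Transfer to the next cell, through [Gamma_{n,1}] and then [Gamma_{n+1,0}]. *)
have vS n : f n e1 0 = c ^+ 2 * f (n + 1) e1 0.
  by rewrite ends -V3 ends V1 mulrA.
(* The loop made of [Gamma_{n,1}] and [Gamma_{n,2}] returns to the same vertex, up to the phase
   [s]. *)
have vs n : s * f n e1 0 = c ^+ 2 * f n e1 0.
  rewrite [RHS](_ : _ = s * (c * (c * f n e2 1))); first by rewrite -ends -V4 -ends.
  by rewrite V2; ring.
have v0 n : f n e1 0 = 0.
  apply/eqP; rewrite -normc_eq0; apply/negP => /negP vn.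
  have sc : c ^+ 2 = s.
    by apply/esym/(mulIf _ (vs n)); rewrite -normc_eq0.
  have nS p : normc (f (p + 1) e1 0) = normc (f p e1 0).
    by rewrite (vS p) normcM sc normc_sk mul1r.
  have nE := int_shift_invariant nS.
  have k0 : 0 < normc (f 0 e1 0).
    by rewrite -(nE n) lt_neqAle eq_sym vn normc_ge0.
  have [d d0 H] := sobolev_lower k0.
  have t0 (g : fam R) a : (0 <= normL2sq (g a.1 a.2))%E.
    by apply: integral_ge0 => x _; rewrite lee_fin nc2_ge0.
  (* The edges [Gamma_{p,1}] suffice: all their initial values have the same modulus, so a single
     [d] bounds every term of the combined sum from below. *)
  have := lte_add_pinfty (le_lt_trans (esum_column e1 (t0 f)) fsum)
                         (le_lt_trans (esum_column e1 (t0 f2)) f2sum).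
  rewrite -esumD; [|by move=> p _; exact: (t0 _ (p, e1))..].
  rewrite (esum_int_pos_lower d0) ?ltxx// => p /=.
  rewrite !normL2sqE// -EFinD lee_fin.
  by have [f1 W] := fW p e1; exact: H W (fL p e1) (nE p).
have w0 n : f n e2 0 = 0.
  by apply/eqP; rewrite -V4 -(mulrI_eq0 _ (mulfI c0)) -ends v0.
move=> n; apply: ord3P.
- rewrite V1 v0; split=> //; by rewrite -(subrK 1 n) V3 V4 w0.
- by rewrite v0 V4 w0.
- by rewrite w0; split=> //; apply/eqP; rewrite -(mulrI_eq0 _ (mulfI sk_neq0)) -V2 v0.
Qed.

(** The coefficient is the derivative at [t = 0], because [phi1 0 = 1]; the derivative at [t = 1] is
    then [A n j * c], which gives the two flux equations. Square summability follows on dividing the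
    squared norm on each edge by [sqnorm phi], which is positive. *)
Lemma inH_edges f : inH q k lam f -> exists A : int -> 'I_3 -> R[i],
  [/\ forall n j x, 0 <= x <= 1 -> f n j x = A n j * phi x,
      forall n j, dR0 (f n j) = A n j,
      forall n, - (A n e0 * c) + A n e1 - s * (A n e2 * c) = 0,
      forall n, A (n + 1) e0 - A n e1 * c + A n e2 = 0
    & forall j, l2Z (fun n => A n j)].
Proof.
move=> fH; have fv := inH_vertices fH.
have [f2 [fW [fL fsum] _ V E]] := fH.
have l1 : 0 <= (1 : R) <= 1 by rewrite lexx ler01.
have key n j : (forall x, 0 <= x <= 1 -> f n j x = dR0 (f n j) * phi x) /\
    dL1 (f n j) = dR0 (f n j) * c.
  have [f1 W] := fW n j; rewrite (dR0_W22w W) (dL1_W22w W).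
  have fs : solves q lam (f n j) f1 (f2 n j) by split; [exact: W|].
  have H := solves_dirichlet Lq phi_solves phi0 phi1_0 fs (fv n j).1.
  by split; [move=> x /H[]|exact: (H 1 l1).2].
exists (fun n j => dR0 (f n j)); split=> //.
- by move=> n j; exact: (key n j).1.
- by move=> n; have [_ _ + _] := V n; rewrite !(key _ _).2.
- by move=> n; have [_ _ _] := V n; rewrite !(key _ _).2.
move=> j.
have t0 a : (0 <= normL2sq (f a.1 a.2))%E.
  by apply: integral_ge0 => x _; rewrite lee_fin nc2_ge0.
have N0 := sqnorm_phi_gt0 phi_solves phi0 phi1_0 phi_1.
have := le_lt_trans (esum_column j t0) fsum => /= jsum.
have i0 : 0 <= (sqnorm phi)^-1 by rewrite invr_ge0 ltW.
have := esumZl_lty i0 (fun p => t0 (p, j)) jsum.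
apply: le_lt_trans; apply: le_esum => n _ /=.
rewrite normL2sqE// -EFinM lee_fin.
have -> : sqnorm (f n j) = sqnorm (fun x => dR0 (f n j) * phi x).
  by apply: eq_Rintegral => x; rewrite inE in_I01 => x01; rewrite (key n j).1.
rewrite sqnormZ; last exact: phi_L2c phi_solves.
by rewrite mulrC mulfK// gt_eqF.
Qed.

(** Converse of [inH_edges]: as [phi] vanishes at both ends, continuity at the vertices is automatic
    and only the flux equations remain. *)
Lemma edges_inH (A : int -> 'I_3 -> R[i]) :
  (forall n, - (A n e0 * c) + A n e1 - s * (A n e2 * c) = 0) ->
  (forall n, A (n + 1) e0 - A n e1 * c + A n e2 = 0) ->
  (forall j, l2Z (fun n => A n j)) ->
  inH q k lam (fun n j x => A n j * phi x).
Proof.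
move=> K1 K2 AL; have [W Eq] := phi_solves; have [L2 _] := W.
have Lphi := phi_L2c phi_solves.
have dR n j : dR0 (fun x => A n j * phi x) = A n j.
  by rewrite (dR0_W22w (W22wZ (A n j) W)) phi1_0 mulr1.
have dL n j : dL1 (fun x => A n j * phi x) = A n j * c.
  by rewrite (dL1_W22w (W22wZ (A n j) W)).
have G (g : R -> R[i]) : L2c g -> L2Gamma (fun n j x => A n j * g x).
  move=> Lg; split; first by move=> n j; exact: L2cZ.
  apply: (@esum_columns_lty _ _ (fun a => normL2sq (fun x => A a.1 a.2 * g x))).
    by move=> a; apply: integral_ge0 => x _; rewrite lee_fin nc2_ge0.
  move=> j /=; have a0 n : (0 <= (nc2 (A n j))%:E)%E by rewrite lee_fin nc2_ge0.
  apply: le_lt_trans (esumZl_lty (sqnorm_ge0 g) a0 (AL j)).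
  apply: le_esum => n _; rewrite normL2sqE; last exact: L2cZ.
  by rewrite sqnormZ// mulrC EFinM.
exists (fun n j x => A n j * phi2 x); split.
- by move=> n j; exists (fun x => A n j * phi1 x); exact: W22wZ.
- exact: G.
- exact: G.
- by move=> n; rewrite !dR !dL phi0 phi_1 !mulr0; split.
- by move=> n j; have [] := solvesZ (A n j) phi_solves.
Qed.
End Eigenfunctions.

(** * Synthesis from the coefficients *)

Section Synthesis.
Variable R : realType.
Variables s c : R[i].
Let eta : R[i] := 1 - s * c ^+ 2.
Implicit Types a : int -> R[i].

(* [psi^(0)] is [coef0 j * phi] on [Gamma_{0,j}] and [coef1 j * phi] on
   [Gamma_{-1,j}], so that [sum_n a_n psi^(n)] is [synthesis a n j * phi] on
   [Gamma_{n,j}]. *)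
Definition coef0 (j : 'I_3) : R[i] :=
  if eta != 0 then (if j == e0 then eta else if j == e1 then c else c ^+ 2)
  else (if j == e0 then 0 else if j == e1 then 1 else c).

Definition coef1 (j : 'I_3) : R[i] :=
  if eta != 0 then (if j == e0 then 0 else if j == e1 then - (s * c) else -1)
  else 0.

Definition synthesis a (n : int) (j : 'I_3) : R[i] :=
  coef0 j * a n + coef1 j * a (n + 1).

Lemma synthesis_kirchhoff0 a n :
  - (synthesis a n e0 * c) + synthesis a n e1 - s * (synthesis a n e2 * c) = 0.
Proof.
rewrite /synthesis /coef0 /coef1; have [h|_] := eqVneq eta 0; rewrite /=.
  by transitivity (eta * a n); [rewrite /eta; ring|rewrite h mul0r].
by rewrite /eta; ring.
Qed.

Lemma synthesis_kirchhoff1 a n :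
  synthesis a (n + 1) e0 - synthesis a n e1 * c + synthesis a n e2 = 0.
Proof.
rewrite /synthesis /coef0 /coef1; have [h|_] := eqVneq eta 0; rewrite /=.
  by ring.
by rewrite /eta; ring.
Qed.

Lemma synthesis_l2Z a j : l2Z a -> l2Z (fun n => synthesis a n j).
Proof. exact: l2Z_combination. Qed.

(** Eliminating [A n e2] leaves [A n e1 * eta = c * A n e0 - s * c * A (n + 1) e0]. For [eta != 0]
    the values on [e0] determine all others. For [eta = 0] the equation no longer sees [A n e1],
    which becomes the free coefficient, and makes the modulus of [A n e0] constant in [n], hence
    zero by square summability. *)
Lemma synthesis_unique (A : int -> 'I_3 -> R[i]) : normc s = 1 -> c != 0 ->
  (forall n, - (A n e0 * c) + A n e1 - s * (A n e2 * c) = 0) ->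
  (forall n, A (n + 1) e0 - A n e1 * c + A n e2 = 0) ->
  l2Z (fun n => A n e0) ->
  forall n j, A n j =
    synthesis (fun n => if eta != 0 then eta^-1 * A n e0 else A n e1) n j.
Proof.
move=> s1 c0 K1 K2 L0 n; rewrite /synthesis /coef0 /coef1.
have A2 p : A p e2 = A p e1 * c - A (p + 1) e0.
  by apply/eqP; rewrite -subr_eq0 -[X in _ == X](K2 p); apply/eqP; ring.
have A1 p : A p e1 * eta = c * A p e0 - s * c * A (p + 1) e0.
  apply/eqP; rewrite -subr_eq0 -[X in _ == X](K1 p) A2 /eta; apply/eqP; ring.
have [h|h] := eqVneq eta 0; last first.
  have A0 p : A p e0 = eta * (eta^-1 * A p e0) by rewrite mulrA divff// mul1r.
  have A1' : A n e1 = c * (eta^-1 * A n e0) - s * c * (eta^-1 * A (n + 1) e0).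
    by apply: (mulIf h); rewrite A1 {1}(A0 n) {1}(A0 (n + 1)); ring.
  apply: ord3P => /=.
  - by rewrite mul0r addr0 -A0.
  - by rewrite A1'; ring.
  - by rewrite A2 A1' {2}(A0 (n + 1)) /eta; ring.
have A0 : forall p, A p e0 = 0.
  apply: (l2Z_const_normc L0) => p.
  have : c * A p e0 = c * (s * A (p + 1) e0).
    apply/eqP; rewrite -subr_eq0; apply/eqP.
    by rewrite -(mulr0 (A p e1)) -h A1; ring.
  by move/(mulfI c0) => ->; rewrite normcM s1 mul1r.
apply: ord3P => /=.
- by rewrite !mul0r addr0.
- by rewrite mul1r mul0r addr0.
- by rewrite A2 A0 subr0 mul0r addr0 mulrC.
Qed.

Lemma symsum_delta a (p : int) (M : nat) : (`|p| <= M)%N ->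
  symsum (fun n => a n * (p == n)%:R) M = a p.
Proof.
move=> pM.
have pM0 : (0 <= p + M%:Z)%R by lia.
have lt : (absz (p + M%:Z)%R < 2 * M + 1)%N by lia.
rewrite /symsum (bigD1 (Ordinal lt))//= gez0_abs// addrK eqxx mulr1.
rewrite big1 ?addr0// => i; rewrite -val_eqE/= => ip.
rewrite (_ : (p == i%:Z - M%:Z) = false) ?mulr0//.
by apply/negbTE; move: ip; apply: contra => /eqP ->; rewrite subrK.
Qed.

End Synthesis.

(** * Correspondence between eigenfunctions and square-summable sequences *)

Theorem theorem1p2 (R : realType) (m : nat) (q : R -> R) (lam : R[i])
    (phi : R -> R[i]) (k : 'I_(2 * m + 1)) :
  L2r q -> is_phi q lam phi -> phi 1 = 0 ->
  (* (i) eigenfunctions vanish at all vertices *)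
  (forall f : fam R, inH q k lam f ->
     forall n j, f n j 0 = 0 /\ f n j 1 = 0) /\
  (* (ii) *)
  (forall n : int, inH q k lam (psin k phi n)) /\
  (forall f : fam R, inH q k lam f ->
     l2Z (fhat k phi f) /\
     forall p j x, I01 x ->
       ((fun M => complex.Re (symsum (fun n => fhat k phi f n * psin k phi n p j x) M))
          @ \oo --> complex.Re (f p j x)) /\
       ((fun M => complex.Im (symsum (fun n => fhat k phi f n * psin k phi n p j x) M))
          @ \oo --> complex.Im (f p j x))) /\
  (forall (f g : fam R) (a : R[i]), inH q k lam f -> inH q k lam g ->
     fhat k phi (fam_add f g) = (fun n => fhat k phi f n + fhat k phi g n) /\
     fhat k phi (fam_scale a f) = (fun n => a * fhat k phi f n)) /\
  (forall f g : fam R, inH q k lam f -> inH q k lam g ->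
     fhat k phi f = fhat k phi g ->
     forall n j x, I01 x -> f n j x = g n j x) /\
  (forall a : int -> R[i], l2Z a ->
     exists f : fam R, inH q k lam f /\ fhat k phi f = a).
Proof.
move=> Lq [[phi1 [phi2 [W Eq]]] phi0 dphi] phi_1.
have phis : solves q lam phi phi1 phi2 by split.
have phi1_0 : phi1 0 = 1 by rewrite -(dR0_W22w W).
have dLphi := dL1_W22w W.
pose s := @sk R m k; pose c := phi1 1; pose eta := 1 - s * c ^+ 2.
have c0 : c != 0 by exact: (phi1_1_neq0 Lq phis).
have fhatE f : fhat k phi f =
    fun n => if eta != 0 then eta^-1 * dR0 (f n e0) else dR0 (f n e1).
  by rewrite /fhat dLphi.
(* Each [psin k phi n] is the synthesis of the unit sequence at [n], which reduces its membership to
   [synH] and the partial sums to [symsum_delta]. *)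
have psinE n p j x :
    psin k phi n p j x = synthesis s c (fun i => (i == n)%:R) p j * phi x.
  rewrite /psin /psi0 dLphi /synthesis /coef0 /coef1 -/s -/c -/eta [p - n == 0]subr_eq0.
  have -> : (p - n == -1) = (p + 1 == n) by rewrite subr_eq addrC -subr_eq opprK.
  have [->|pn] := eqVneq p n.
    rewrite (_ : (n + 1 == n) = false); last by apply/negbTE/eqP; lia.
    by case: (eta != 0); case: (j == e0); case: (j == e1);
      rewrite /= ?mulr1n ?mulr0n; ring.
  by case: (eta != 0); case: (p + 1 == n); case: (j == e0); case: (j == e1);
      rewrite /= ?mulr1n ?mulr0n; ring.
have edges f : inH q k lam f -> l2Z (fhat k phi f) /\
    forall n j x, 0 <= x <= 1 -> f n j x = synthesis s c (fhat k phi f) n j * phi x.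
  move=> fH; have [A [fA dA K1 K2 AL]] := inH_edges Lq phis phi0 phi1_0 phi_1 fH.
  have fE : fhat k phi f = fun n => if eta != 0 then eta^-1 * A n e0 else A n e1.
    by rewrite fhatE; apply/funext => n; rewrite !dA.
  split.
    by rewrite fE; case: (eta != 0); [exact: l2ZZ|exact: AL].
  move=> n j x x01; rewrite fA// fE; congr (_ * _).
  by apply: synthesis_unique => //; exact: normc_sk.
have synH a : l2Z a -> inH q k lam (fun n j x => synthesis s c a n j * phi x).
  move=> la; apply: (edges_inH phis) => //.
  - exact: synthesis_kirchhoff0.
  - exact: synthesis_kirchhoff1.
  - by move=> j; exact: synthesis_l2Z.
split; first by move=> f; exact: (inH_vertices Lq phis).
split.
  move=> n; rewrite (_ : psin k phi n = fun p j x =>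
      synthesis s c (fun i => (i == n)%:R) p j * phi x).
    by apply: synH; exact: l2Z_delta.
  by apply/funext => p; apply/funext => j; apply/funext => x; exact: psinE.
split.
  move=> f /edges[lf fE]; split=> // p j x; rewrite in_I01 => x01.
  (* Only [n = p] and [n = p + 1] contribute on [Gamma_{p,j}], so the symmetric sums are constant
     once they contain both indices; hence the [+ 1]. *)
  have E M : (`|p| + 1 <= M)%N ->
      symsum (fun n => fhat k phi f n * psin k phi n p j x) M = f p j x.
    move=> pM; rewrite fE//.
    have -> : (fun n => fhat k phi f n * psin k phi n p j x) = fun n =>
        coef0 s c j * phi x * (fhat k phi f n * (p == n)%:R) +
        coef1 s c j * phi x * (fhat k phi f n * (p + 1 == n)%:R).
      by apply/funext => n; rewrite psinE /synthesis; ring.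
    rewrite /symsum big_split/= -!mulr_sumr.
    have := @symsum_delta R (fhat k phi f) p M; rewrite /symsum => ->; last by lia.
    have := @symsum_delta R (fhat k phi f) (p + 1) M; rewrite /symsum => ->; last by lia.
    by rewrite /synthesis; ring.
  by split; apply: cvg_near_cst; exists (`|p| + 1)%N => // M /= /E ->.
split.
  (* [dR0] is built from [lim], which is linear only where limits exist; the [W22w] representatives
     provide them. *)
  move=> f g a [f2 [fW _ _ _ _]] [g2 [gW _ _ _ _]].
  have add n j : dR0 (fam_add f g n j) = dR0 (f n j) + dR0 (g n j).
    have [f1 Wf] := fW n j; have [g1 Wg] := gW n j.
    by rewrite (dR0_W22w (W22wD Wf Wg)) (dR0_W22w Wf) (dR0_W22w Wg).
  have scale n j : dR0 (fam_scale a f n j) = a * dR0 (f n j).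
    have [f1 Wf] := fW n j.
    by rewrite (dR0_W22w (W22wZ a Wf)) (dR0_W22w Wf).
  rewrite !fhatE; split; apply/funext => n; rewrite ?add ?scale.
    by case: ifP => _; rewrite ?mulrDr.
  by case: ifP => _; rewrite // mulrCA.
split.
  move=> f g /edges[_ fE] /edges[_ gE] fg n j x; rewrite in_I01 => x01.
  by rewrite fE// gE// fg.
move=> a la; exists (fun n j x => synthesis s c a n j * phi x); split; first exact: synH.
have dE n j : dR0 (fun x => synthesis s c a n j * phi x) = synthesis s c a n j.
  by rewrite (dR0_W22w (W22wZ (synthesis s c a n j) W)) phi1_0 mulr1.
(* On the edge that [fhat] reads, [coef1] is zero in both cases, so the neighbouring coefficient
   [a (n + 1)] drops out. *)
rewrite fhatE; apply/funext => n; rewrite !dE /synthesis /coef0 /coef1 -/eta.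
have [h|h] := eqVneq eta 0 => /=.
  by rewrite mul1r mul0r addr0.
by rewrite mul0r addr0 mulKf.
Qed.
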